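(* Let $k\geq 2$ be a fixed integer and let $p=p(n)$ satisfy $\frac{\log n}{n^{(k-1)/k}}\leq p\leq 1-\Omega\!\left(\frac{\log^4 n}{n}\right)$. Let $G\sim G(n,p)$ and let $v\neq w\in V(G)$. Then, with high probability, \[ H_{wv} = \frac{2|E(G)|}{d(v)} - 1 + \frac{2|E(G)|}{d(v)}\cdot \frac{1}{|N(v)|} \sum_{u\in N(v)}\sum_{i=1}^{3k+1}\left(\frac{\mathcal{W}_i(u,v)}{\mathcal{W}_i(u)}-\frac{\mathcal{W}_i(w,v)}{\mathcal{W}_i(w)}\right) \pm\mathcal{O}\!\left(\frac{\sqrt{\log n}}{p^{3/2}\sqrt{n}}\right). \]
   Context: $G(n,p)$ is the binomial random graph on $n$ vertices in which each edge is present independently with probability $p$; ''with high probability'' means with probability tending to $1$ as $n\to\infty$. All asymptotic notation is with respect to $n\to\infty$; $p\le 1-\Omega(\log^4 n/n)$ means $1-p\geq c\log^4 n/n$ for some constant $c>0$. For a graph $G$ and vertices $v,w$, $H_{wv}$ denotes the expected number of steps a simple random walk on $G$ started at $w$ needs to first hit $v$. $d(v)=|N(v)|$ is the degree of $v$ and $N(v)$ its neighbourhood. $\mathcal{W}_i(w)$ is the number of walks of length $i$ in $G$ starting at $w$, and $\mathcal{W}_i(w,v)$ is the number of walks of length $i$ from $w$ to $v$. The notation $a=b\pm\mathcal{O}(f)$ means $|a-b|\le Cf$ for a constant $C$ independent of $n$. *)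

(* Defs.v *)
From HB Require Import structures.
From mathcomp Require Import all_boot all_order all_algebra.
From mathcomp Require Import all_classical all_reals all_analysis.
Set Implicit Arguments. Unset Strict Implicit. Unset Printing Implicit Defensive.
Import Order.TTheory GRing.Theory Num.Theory.
Local Open Scope ring_scope.

Section GnpDefs.
Variable R : realType.
Variable n : nat.

Definition upper : {set 'I_n * 'I_n} := [set ij : 'I_n * 'I_n | (ij.1 < ij.2)%N].
Definition is_graph (E : {set 'I_n * 'I_n}) : bool := E \subset upper.

Definition adj (E : {set 'I_n * 'I_n}) : rel 'I_n :=
  fun x y => ((x, y) \in E) || ((y, x) \in E).
Definition nbhd (E : {set 'I_n * 'I_n}) (x : 'I_n) : {set 'I_n} :=
  [set y | adj E x y].
Definition deg (E : {set 'I_n * 'I_n}) (x : 'I_n) : nat := #|nbhd E x|.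

Definition gnp_weight (p : R) (E : {set 'I_n * 'I_n}) : R :=
  \prod_(ij in upper) (if ij \in E then p else 1 - p).
Definition gnp_prob (p : R) (P : {set 'I_n * 'I_n} -> Prop) : R :=
  \sum_(E : {set 'I_n * 'I_n} | is_graph E && `[< P E >]) gnp_weight p E.

Definition trans (E : {set 'I_n * 'I_n}) (x y : 'I_n) : R :=
  if deg E x == 0%N then (x == y)%:R else (adj E x y)%:R / (deg E x)%:R.

Fixpoint walk_prob (E : {set 'I_n * 'I_n}) (x : 'I_n) (s : seq 'I_n) : R :=
  if s is y :: s' then trans E x y * walk_prob E y s' else 1.

Definition avoid_prob (E : {set 'I_n * 'I_n}) (w v : 'I_n) (t : nat) : R :=
  \sum_(s : t.-tuple 'I_n) (all (fun u => u != v) (w :: s))%:R * walk_prob E w s.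

(* expected hitting time H_{wv} = E_w[T_v] = sum_{t>=0} P_w(T_v > t),
   an extended real (+oo if v is not reached almost surely) *)
Definition hit (E : {set 'I_n * 'I_n}) (w v : 'I_n) : \bar R :=
  (\sum_(0 <= t <oo) (avoid_prob E w v t)%:E)%E.

Definition nwalks (E : {set 'I_n * 'I_n}) (i : nat) (w : 'I_n) : nat :=
  #|[set s : i.-tuple 'I_n | path (adj E) w s]|.
Definition nwalks_to (E : {set 'I_n * 'I_n}) (i : nat) (w v : 'I_n) : nat :=
  #|[set s : i.-tuple 'I_n | path (adj E) w s && (last w s == v)]|.

Definition main_term (E : {set 'I_n * 'I_n}) (k : nat) (w v : 'I_n) : R :=
  let m2 := 2 * (#|E|)%:R in
  let dv := (deg E v)%:R in
  m2 / dv - 1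
  + m2 / dv * (1 / (#|nbhd E v|)%:R) *
    \sum_(u in nbhd E v) \sum_(1 <= i < 3 * k + 2)
       ((nwalks_to E i u v)%:R / (nwalks E i u)%:R
        - (nwalks_to E i w v)%:R / (nwalks E i w)%:R).

End GnpDefs.

Definition err_term (R : realType) (n : nat) (p : R) : R :=
  Num.sqrt (ln (n%:R : R)) / (p `^ (3%:R / 2%:R) * Num.sqrt (n%:R : R)).

Arguments gnp_prob {R} n p P.
Arguments hit {R n} E w v.
Arguments main_term {R n} E k w v.
Arguments trans {R n} E x y.
Arguments walk_prob {R n} E x s.
Arguments avoid_prob {R n} E w v t.

(* Main.v *)
(* Write P for the transition matrix, pi_v = d(v) / 2|E| and
   g_i(x) = P^i(x,v) - pi_v.  The function
   h(x) = (1 / pi_v) sum_(i >= 0) (g_i(v) - g_i(x)) solves the hitting-time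
   equations, which gives the exact formula
     H_wv = 1/pi_v - 1
            + (1/pi_v) sum_(i >= 1) (P^(i+1)(v,v) - P^i(w,v)),
   where P^(i+1)(v,v) is the average of P^i(u,v) over u in N(v).

   Let D = n p and r = 4 sqrt(log n / D).  By Chernoff all degrees lie in
   [D(1-r), D(1+r)], so W_i(u,v) / W_i(u) = P^i(u,v) (1 + O(r)), and
   P^i(u,v) = O(1/D); hence the terms i <= 3k+1 contribute an error
   O(n r / D), which is the error of the statement.

   For the tail, L^2(d)-norms of g contract over s = k+1 steps by the factor
   (Tr P^(2s) - 1)^(1/2) (Hilbert-Schmidt norm), and as 2s <= 3k it is enough
   that Tr P^(2s) = 1 + O(r).  This trace is at most
   (number of closed walks of length 2s) / (D(1-r))^(2s), and the number of
   closed walks is controlled by the second moment of W_s(x,y) - D^s/n.  In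
   expectation a closed walk with V vertices and e edges weighs n^V p^e; either
   e = 2s, or V <= e < 2s, or the walk traces a tree and uses each edge twice,
   so that V = e + 1 <= s + 1 and n D^s <= D^(2s-1) because n <= D^k.  Markov's
   inequality concludes. *)
Require Import Defs.
From HB Require Import structures.
From mathcomp Require Import all_boot all_order all_algebra.
From mathcomp Require Import all_classical all_reals all_analysis.
From mathcomp Require Import ring lra zify.
Import Order.TTheory GRing.Theory Num.Theory.
Import numFieldNormedType.Exports.
Local Open Scope ring_scope.
Set Implicit Arguments.
Unset Strict Implicit.

(** * Reversible chains: mixing and hitting times *)

(** Lagrange's identity: the weighted double sum of squared determinants [a i * b j - a j * b i] is
    twice the difference of the two sides. *)
Lemma sum_CauchySchwarz (R : realFieldType) (I : finType) (w a b : I -> R) :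
  (forall i, 0 <= w i) ->
  (\sum_i w i * (a i * b i)) ^+ 2
    <= (\sum_i w i * a i ^+ 2) * (\sum_i w i * b i ^+ 2).
Proof.
move=> w0.
set A := \sum_i _ * a _ ^+ 2; set B := \sum_i _ * b _ ^+ 2.
set C := \sum_i _.
have H : 0 <= \sum_i \sum_j w i * w j * (a i * b j - a j * b i) ^+ 2.
  apply: sumr_ge0 => i _; apply: sumr_ge0 => j _.
  by rewrite mulr_ge0 ?sqr_ge0 ?mulr_ge0.
suff E : \sum_i \sum_j w i * w j * (a i * b j - a j * b i) ^+ 2 =
    A * B + B * A - 2 * (C * C).
  by rewrite E in H; rewrite expr2; nra.
rewrite /A /B /C !big_distrlr /= mulr_sumr -big_split -sumrB /=.
apply: eq_bigr => i _.
rewrite mulr_sumr -big_split -sumrB /=.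
by apply: eq_bigr => j _; ring.
Qed.

Lemma abs_series_bound (R : realType) (u : nat -> R) (m : nat) (B : R) :
  (forall N, \sum_(m <= i < N) `|u i| <= B) ->
  exists l : R, (series u @ \oo --> l)%classic /\
    (forall M, (m <= M)%N -> `|l - \sum_(0 <= i < M) u i| <= B).
Proof.
move=> uB.
have bnd N : \sum_(0 <= i < N) `|u i| <= \sum_(0 <= i < m) `|u i| + B.
  have B0 : 0 <= B by apply: le_trans (uB m); apply: sumr_ge0.
  have [Nm|mN] := leqP N m.
    rewrite (big_cat_nat (leq0n N) Nm) //= -addrA lerDl addr_ge0 //.
    by apply: sumr_ge0.
  by rewrite (big_cat_nat (leq0n m) (ltnW mN)) //= lerD2l.
have cu : cvgn (series u).
  apply: normed_cvg; apply: nondecreasing_is_cvgn.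
    by apply: nondecreasing_series => n _ _; exact: normr_ge0.
  exists (\sum_(0 <= i < m) `|u i| + B) => _ [N _ <-].
  by rewrite /series /=; exact: bnd.
exists (limn (series u)); split; first exact: cu.
move=> M mM.
have cv : (series u N - \sum_(0 <= i < M) u i @[N --> \oo] -->
   limn (series u) - \sum_(0 <= i < M) u i)%classic.
  by apply: cvgB; [exact: cu|exact: cvg_cst].
have cv' : (`|series u N - \sum_(0 <= i < M) u i| @[N --> \oo] -->
   `|limn (series u) - \sum_(0 <= i < M) u i|)%classic by exact: cvg_norm.
rewrite -(cvg_lim _ cv') //.
apply: limr_le; first by apply: cvgP cv'.
near=> N.
have MN : (M <= N)%N by near: N; exact: nbhs_infty_ge.
rewrite /series /= (big_cat_nat (leq0n M) MN) //= addrAC subrr add0r.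
apply: le_trans (uB N); apply: le_trans (ler_norm_sum _ _ _) _.
by rewrite [leRHS](big_cat_nat mM MN) //= lerDr; apply: sumr_ge0.
Unshelve. all: by end_near. Qed.

(** Shifting by [L] bounds the tail by [q] times the whole sum from 1, that is, by [q] times the
    head plus [q] times the tail. The head is at most [L * a 1] by monotonicity, and [q <= 1 / 2]
    absorbs the tail on the right. *)
Lemma geometric_decay_tail (R : realFieldType) (a : nat -> R) (L : nat) (q : R) :
  (forall j, 0 <= a j) -> (forall j, a j.+1 <= a j) ->
  (forall j, a (L + j)%N <= q * a j) -> 0 <= q -> q <= 1 / 2 ->
  forall N, \sum_(L.+1 <= j < N) a j <= 2 * q * L%:R * a 1%N.
Proof.
move=> a0 am aq q0 q1 N.
have head M : \sum_(1 <= j < M.+1) a j <= M%:R * a 1%N.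
  elim: M => [|M IH]; first by rewrite big_geq // mul0r.
  rewrite big_nat_recr //= -natr1 mulrDl mul1r lerD //.
  by elim: {IH} M => [|M IH] //; exact: le_trans (am _) IH.
have tail0 M : 0 <= \sum_(L.+1 <= j < M) a j by apply: sumr_ge0.
have shift M : \sum_(L.+1 <= j < L + M) a j <= q * \sum_(1 <= j < M) a j.
  rewrite -[L.+1]add1n [(L + M)%N]addnC big_addn addnK mulr_sumr.
  by apply: ler_sum => j _; rewrite addnC.
have grow M : (L.+1 <= M)%N ->
    \sum_(1 <= j < M) a j <= L%:R * a 1%N + \sum_(L.+1 <= j < M) a j.
  by move=> LM; rewrite (@big_cat_nat _ _ _ L.+1 1) //= lerD2r head.
have [NL|NL] := leqP N L.+1.
  by rewrite big_geq // !mulr_ge0.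
have S1 := shift N.
have S2 : \sum_(L.+1 <= j < N) a j <= \sum_(L.+1 <= j < L + N) a j.
  rewrite [leRHS](@big_cat_nat _ _ _ N) ?leq_addl //=; last exact: ltnW.
  by rewrite lerDl; apply: sumr_ge0.
have S3 := grow N (ltnW NL).
have S4 : q * \sum_(1 <= j < N) a j
    <= q * (L%:R * a 1%N) + q * \sum_(L.+1 <= j < N) a j.
  by rewrite -mulrDr ler_wpM2l.
have S5 : q * \sum_(L.+1 <= j < N) a j <= 1 / 2 * \sum_(L.+1 <= j < N) a j.
  by rewrite ler_wpM2r.
have {S1 S2 S3 S4} := le_trans S2 (le_trans S1 S4).
rewrite -mulrA -mulrA; lra.
Qed.

Section ReversibleChain.
Variables (R : realType) (T : finType) (P : T -> T -> R) (d : T -> R).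
Hypothesis P_ge0 : forall x y, 0 <= P x y.
Hypothesis P_sum1 : forall x, \sum_y P x y = 1.
Hypothesis d_gt0 : forall x, 0 < d x.
Hypothesis P_rev : forall x y, d x * P x y = d y * P y x.

Fixpoint kpow (i : nat) (x y : T) : R :=
  if i is j.+1 then \sum_z P x z * kpow j z y else (x == y)%:R.

Lemma kpow_ge0 i x y : 0 <= kpow i x y.
Proof.
elim: i x => [|i IH] x /=; first exact: ler0n.
by apply: sumr_ge0 => z _; rewrite mulr_ge0.
Qed.

Lemma kpow_sum1 i x : \sum_y kpow i x y = 1.
Proof.
elim: i x => [|i IH] x /=.
  rewrite (bigD1 x) //= eqxx big1 ?addr0 // => y /negbTE.
  by rewrite eq_sym => ->.
rewrite exchange_big /= -[RHS](P_sum1 x).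
by apply: eq_bigr => z _; rewrite -mulr_sumr IH mulr1.
Qed.

Lemma kpowD i j x y : kpow (i + j) x y = \sum_z kpow i x z * kpow j z y.
Proof.
elim: i x => [|i IH] x /=.
  rewrite (bigD1 x) //= eqxx mul1r big1 ?addr0 // => z /negbTE.
  by rewrite eq_sym => ->; rewrite mul0r.
under [RHS]eq_bigr => z _ do rewrite mulr_suml.
rewrite exchange_big /=; apply: eq_bigr => u _.
by rewrite IH mulr_sumr; apply: eq_bigr => z _; rewrite mulrA.
Qed.

Lemma kpow1 x y : kpow 1 x y = P x y.
Proof.
rewrite /= (bigD1 y) //= eqxx mulr1 big1 ?addr0 // => z /negbTE ->.
by rewrite mulr0.
Qed.

Lemma kpow_rev i x y : d x * kpow i x y = d y * kpow i y x.
Proof.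
elim: i x y => [|i IH] x y.
  by rewrite /= [y == x]eq_sym; case: eqVneq => [->|] //=; rewrite !mulr0.
rewrite -[in RHS]addn1 kpowD [LHS]/= !mulr_sumr; apply: eq_bigr => z _.
by rewrite kpow1 mulrA P_rev mulrAC IH mulrA.
Qed.

Let vol : R := \sum_x d x.

Lemma vol_gt0 (x : T) : 0 < vol.
Proof.
by rewrite /vol (bigD1 x) //= ltr_wpDr // sumr_ge0 // => y _; exact: ltW.
Qed.

(** * Decay of the deviation from stationarity at a target [v] *)

Variable v : T.

(** [dev i] is the function g_i of the overview. [dev_norm i] is its squared L^2(d)-norm, so bounds
    on [dev] itself involve square roots. *)
Definition dev (i : nat) (x : T) : R := kpow i x v - d v / vol.
Definition dev_norm (i : nat) : R := \sum_x d x * dev i x ^+ 2.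

Lemma dev_norm_ge0 i : 0 <= dev_norm i.
Proof. by apply: sumr_ge0 => x _; rewrite mulr_ge0 ?sqr_ge0 // ltW. Qed.

Lemma devD s i x : dev (s + i) x = \sum_y kpow s x y * dev i y.
Proof.
rewrite /dev kpowD; under [RHS]eq_bigr => y _ do rewrite mulrBr.
by rewrite sumrB -mulr_suml kpow_sum1 mul1r.
Qed.

Lemma devS i x : dev i.+1 x = \sum_y P x y * dev i y.
Proof. by rewrite -add1n devD; apply: eq_bigr => y _; rewrite kpow1. Qed.

(** Orthogonality to constants: reversibility turns the sum over starting points into a row sum of
    [kpow i v]. This is what allows the constant mode of the kernel to be subtracted. *)
Lemma dev_mean0 i : \sum_x d x * dev i x = 0.
Proof.
rewrite /dev; under eq_bigr => x _ do rewrite mulrBr kpow_rev.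
rewrite sumrB -mulr_sumr -mulr_suml kpow_sum1 -/vol.
by rewrite mulr1 mulrC divfK ?subrr // gt_eqF // vol_gt0.
Qed.

(** Jensen's inequality in each row of [P], followed by invariance of [d] under [P]. *)
Lemma dev_norm_nonincr i : dev_norm i.+1 <= dev_norm i.
Proof.
rewrite /dev_norm.
have step x : d x * dev i.+1 x ^+ 2 <= \sum_y d x * P x y * dev i y ^+ 2.
  rewrite -(eq_bigr _ (fun y _ => mulrA (d x) (P x y) _)) -mulr_sumr.
  rewrite ler_wpM2l ?(ltW (d_gt0 _)) // devS.
  have := @sum_CauchySchwarz R T (P x) (fun=> 1) (dev i) (P_ge0 x).
  under eq_bigr => y _ do rewrite mul1r.
  under [X in X * _]eq_bigr => y _ do rewrite expr1n mulr1.
  by rewrite P_sum1 mul1r.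
apply: le_trans (ler_sum _ (fun x _ => step x)) _.
rewrite exchange_big /=; apply: ler_sum => y _.
under eq_bigr => x _ do rewrite P_rev.
by rewrite -mulr_suml -mulr_sumr P_sum1 mulr1.
Qed.

(* The squared Hilbert-Schmidt norm, in L^2(d), of the s-step kernel with its
   constant mode removed equals Tr P^(2s) - 1. *)
Lemma hilbert_schmidt_trace s :
  \sum_x d x * \sum_y d y * (kpow s x y / d y - vol^-1) ^+ 2
    = \sum_x kpow (s + s) x x - 1.
Proof.
have v0 : vol != 0 by rewrite gt_eqF // (vol_gt0 v).
have E x : d x * \sum_y d y * (kpow s x y / d y - vol^-1) ^+ 2 =
    kpow (s + s) x x - d x / vol.
  rewrite kpowD.
  have -> : d x / vol = 2 * (d x / vol) * (\sum_y kpow s x y)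
       - d x / vol ^+ 2 * \sum_y d y.
    rewrite kpow_sum1 -/vol; field; exact: v0.
  rewrite !mulr_sumr -!sumrB; apply: eq_bigr => y _.
  have dy : d y != 0 by rewrite gt_eqF.
  have -> : kpow s y x = d x * kpow s x y / d y.
    by rewrite kpow_rev mulrAC mulfV // mul1r.
  field; by rewrite v0 dy.
under eq_bigr => x _ do rewrite E.
by rewrite sumrB -mulr_suml -/vol mulfV.
Qed.

(** Since [dev i] has mean zero, the s-step kernel may be replaced by the kernel without its
    constant mode. Cauchy-Schwarz in each row then leaves the Hilbert-Schmidt norm. *)
Lemma dev_norm_contract s i :
  dev_norm (s + i) <= (\sum_x kpow (s + s) x x - 1) * dev_norm i.
Proof.
rewrite -hilbert_schmidt_trace [leLHS]/dev_norm mulr_suml.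
apply: ler_sum => x _; rewrite -mulrA ler_wpM2l ?(ltW (d_gt0 _)) //.
have -> : dev (s + i) x =
    \sum_y d y * ((kpow s x y / d y - vol^-1) * dev i y).
  have -> : dev (s + i) x = \sum_y kpow s x y * dev i y
     - vol^-1 * \sum_y d y * dev i y.
    by rewrite dev_mean0 mulr0 subr0 devD.
  rewrite mulr_sumr -sumrB; apply: eq_bigr => y _.
  have dy : d y != 0 by rewrite gt_eqF.
  have v0 : vol != 0 by rewrite gt_eqF // (vol_gt0 v).
  field; by rewrite v0 dy.
by apply: sum_CauchySchwarz => y; exact: ltW.
Qed.

Variable a : R.
Hypothesis a_gt0 : 0 < a.
Hypothesis a_le_d : forall x, a <= d x.
Hypothesis P_le : forall x y, P x y <= a^-1.

Lemma kpow_le i x : kpow i.+1 x v <= a^-1.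
Proof.
elim: i x => [|i IH] x; first by rewrite kpow1.
rewrite [kpow _ _ _]/=.
apply: le_trans (_ : \sum_z P x z * a^-1 <= _).
  by apply: ler_sum => z _; rewrite ler_wpM2l // IH.
by rewrite -mulr_suml P_sum1 mul1r.
Qed.

(** Expanding the square, the mean part only subtracts [d v ^+ 2 / vol]. In the rest, one factor
    [P x v] is at most [a^-1] and the other is summed by reversibility. *)
Lemma dev_norm1_le : dev_norm 1 <= d v / a.
Proof.
have v0 : vol != 0 by rewrite gt_eqF // (vol_gt0 v).
have -> : dev_norm 1 = \sum_x d x * P x v ^+ 2 - d v ^+ 2 / vol.
  rewrite /dev_norm; under eq_bigr => x _.
    rewrite (_ : _ * _ = (d x * P x v ^+ 2)
       - (2 * d v / vol) * (d v * P v x) + (d v / vol) ^+ 2 * d x); last first.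
      rewrite /dev kpow1 -P_rev; field; exact: v0.
    over.
  rewrite big_split sumrB -!mulr_sumr P_sum1 -/vol /=; field; exact: v0.
apply: le_trans (_ : \sum_x d x * P x v ^+ 2 <= _).
  by rewrite lerBlDr lerDl divr_ge0 ?sqr_ge0 // ltW // (vol_gt0 v).
apply: le_trans (_ : \sum_x d v / a * P v x <= _); last first.
  by rewrite -mulr_sumr P_sum1 mulr1.
apply: ler_sum => x _.
rewrite expr2 mulrA P_rev mulrAC ler_wpM2r // ler_wpM2l ?P_le //.
exact: ltW.
Qed.

(** One step of the chain smooths: Cauchy-Schwarz against the density [P w y / d y], whose squared
    L^2(d)-norm is at most [a^-1 ^+ 2], turns a norm bound into a pointwise one. *)
Lemma dev_le i w : `|dev i.+1 w| <= a^-1 * Num.sqrt (dev_norm i).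
Proof.
have H : dev i.+1 w ^+ 2 <= a^-1 ^+ 2 * dev_norm i.
  have -> : dev i.+1 w = \sum_y d y * ((P w y / d y) * dev i y).
    rewrite devS; apply: eq_bigr => y _.
    have dy : d y != 0 by rewrite gt_eqF.
    by rewrite mulrA mulrCA mulfV // mulr1.
  apply: le_trans (sum_CauchySchwarz _ _ (fun y => ltW (d_gt0 y))) _.
  apply: ler_wpM2r; first exact: dev_norm_ge0.
  apply: le_trans (_ : \sum_y a^-1 ^+ 2 * P w y <= _); last first.
    by rewrite -mulr_sumr P_sum1 mulr1.
  apply: ler_sum => y _.
  have dy : d y != 0 by rewrite gt_eqF.
  have -> : d y * (P w y / d y) ^+ 2 = (P w y * (d y)^-1) * P w y by field.
  rewrite ler_wpM2r // expr2 ler_pM ?P_le //.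
    by rewrite invr_ge0 ltW.
  by rewrite lef_pV2 ?posrE.
have ai0 : 0 <= a^-1 by rewrite invr_ge0 ltW.
rewrite -[X in X * _](ger0_norm ai0) -!sqrtr_sqr -sqrtrM ?sqr_ge0 //.
by rewrite ler_sqrt // mulr_ge0 ?sqr_ge0 // dev_norm_ge0.
Qed.

Variables (s : nat) (q : R).
Hypothesis q_ge0 : 0 <= q.
Hypothesis q_le : q <= 1 / 2.
Hypothesis trace_le : \sum_x kpow (s + s) x x - 1 <= q.

Definition tail_bound : R :=
  a^-1 * (2 * q * (s + s)%:R * Num.sqrt (d v / a)).

(** Squared norms contract by [q] over [s] steps, hence norms contract by [q] over [s + s] steps,
    which is the period used. The extra index shift in the starting point comes from [dev_le], which
    bounds [dev i.+1] by the norm at [i]. *)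
Lemma dev_tail w N : \sum_((s + s).+2 <= i < N) `|dev i w| <= tail_bound.
Proof.
case: N => [|N]; first by rewrite big_geq // !mulr_ge0 // ?invr_ge0 ?sqrtr_ge0 // ltW.
rewrite big_add1 /=.
apply: le_trans (_ : \sum_((s + s).+1 <= i < N) a^-1 * Num.sqrt (dev_norm i) <= _).
  by apply: ler_sum => i _; exact: dev_le.
rewrite -mulr_sumr ler_wpM2l ?invr_ge0 ?(ltW a_gt0) //.
apply: le_trans (_ : 2 * q * (s + s)%:R * Num.sqrt (dev_norm 1) <= _); last first.
  rewrite ler_wpM2l ?mulr_ge0 // ler_sqrt ?dev_norm1_le //.
  by rewrite divr_ge0 // ltW.
apply: (@geometric_decay_tail _ (fun i => Num.sqrt (dev_norm i))) => //.
- by move=> j /=; rewrite ler_sqrt ?dev_norm_nonincr ?dev_norm_ge0.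
move=> j /=.
have step i : dev_norm (s + i) <= q * dev_norm i.
  by apply: le_trans (dev_norm_contract _ _) _; rewrite ler_wpM2r ?dev_norm_ge0.
rewrite -[X in X * _](ger0_norm q_ge0) -sqrtr_sqr -sqrtrM ?sqr_ge0 // ler_sqrt.
  rewrite -addnA; apply: le_trans (step _) _.
  by rewrite expr2 -mulrA ler_wpM2l.
by rewrite mulr_ge0 ?sqr_ge0 // dev_norm_ge0.
Qed.

(** * Hitting times as sums of deviations *)

Fixpoint avoid (t : nat) (x : T) : R :=
  (x != v)%:R * (if t is t'.+1 then \sum_y P x y * avoid t' y else 1).

Lemma avoid_ge0 t x : 0 <= avoid t x.
Proof.
elim: t x => [|t IH] x /=; first by rewrite mulr1 ler0n.
by rewrite mulr_ge0 ?ler0n // sumr_ge0 // => y _; rewrite mulr_ge0.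
Qed.

(* A bounded solution of the hitting-time equations is nonnegative by the
   minimum principle, and therefore is the sum of the avoidance series. *)
Lemma hitting_system (h : T -> R) : h v = 0 ->
  (forall x, x != v -> h x = 1 + \sum_y P x y * h y) ->
  forall x, (series (avoid ^~ x) @ \oo --> h x)%classic.
Proof.
move=> hv hE.
have h0 x : 0 <= h x.
  have [m _ hm] := @arg_minP _ _ _ x xpredT h isT.
  apply: le_trans (hm x isT).
  have [->|mv] := eqVneq m v; first by rewrite hv.
  (* At a minimizer [m] other than [v] the equation reads [h m] = 1 + (an average of [h]), which is
     at least [1 + h m]. *)
  exfalso; have := hE _ mv; apply/eqP; rewrite lt_eqF //.
  apply: (@lt_le_trans _ _ (1 + h m)); first by rewrite ltrDr.
  rewrite lerD2l -[leLHS]mul1r -(P_sum1 m) mulr_suml.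
  by apply: ler_sum => y _; rewrite ler_wpM2l // hm.
pose H := \sum_x h x.
have hH x : h x <= H.
  by rewrite /H (bigD1 x) //= lerDl sumr_ge0.
(* rem t = K^t h for the chain K killed at v *)
pose fix rem (t : nat) (x : T) {struct t} : R :=
  if t is t'.+1 then (x != v)%:R * \sum_y P x y * rem t' y else h x.
have rem0 t x : 0 <= rem t x.
  elim: t x => [|t IH] x //=.
  by rewrite mulr_ge0 ?ler0n // sumr_ge0 // => y _; rewrite mulr_ge0.
have remH t x : rem t x <= H * avoid t x.
  elim: t x => [|t IH] x /=.
    rewrite mulr1; have [->|_] := eqVneq x v; first by rewrite hv mulr0.
    by rewrite mulr1.
  rewrite mulrCA ler_wpM2l ?ler0n // mulr_sumr ler_sum // => y _.
  by rewrite mulrCA ler_wpM2l.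
have remE t x : rem t x = avoid t x + rem t.+1 x.
  elim: t x => [|t IH] x.
    rewrite /= mulr1; have [->|xv] := eqVneq x v; first by rewrite hv mul0r addr0.
    by rewrite hE //= mul1r.
  rewrite [LHS]/= [rem t.+2 x]/= [avoid _ _]/= -mulrDr -big_split /=.
  by congr (_ * _); apply: eq_bigr => y _; rewrite -mulrDr IH.
have sumE N x : \sum_(0 <= t < N) avoid t x = h x - rem N x.
  elim: N => [|N IH]; first by rewrite big_geq //= subrr.
  by rewrite big_nat_recr // [LHS]/= IH (remE N); ring.
move=> x.
(* The partial sums of [avoid] are bounded by [h x], so its terms tend to 0; the remainder [rem], at
   most [H] times such a term, tends to 0 as well. *)
have av_cvg : (avoid t x @[t --> \oo] --> 0)%classic.
  have : cvgn (series (avoid ^~ x)).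
    apply: nondecreasing_is_cvgn.
      by apply: nondecreasing_series => n _ _; exact: avoid_ge0.
    by exists (h x) => _ [N _ <-]; rewrite /series /= sumE lerBlDr lerDl.
  exact: cvg_series_cvg_0.
have rem_cvg : (rem t x @[t --> \oo] --> 0)%classic.
  apply: (@squeeze_cvgr _ _ _ _ (cst 0) (fun t => H * avoid t x)).
  - by near=> t; rewrite /= rem0 remH.
  - exact: cvg_cst.
  - rewrite -[X in (_ --> X)%classic](mulr0 H); apply: cvgM => //.
    exact: cvg_cst.
rewrite (_ : series _ = fun N => h x - rem N x); last first.
  by apply/boolp.funext => N; rewrite /series /= sumE.
rewrite -[X in (_ --> X)%classic](subr0 (h x)); apply: cvgB => //.
exact: cvg_cst.
Unshelve. all: by end_near. Qed.

Lemma hitting_time_expansion w M : P v v = 0 -> w != v -> ((s + s).+2 <= M)%N ->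
  exists h : R, (series (avoid ^~ w) @ \oo --> h)%classic /\
   `|h - (vol / d v - 1 + vol / d v *
       \sum_(1 <= i < M) (kpow i.+1 v v - kpow i w v))|
      <= vol / d v * (tail_bound + tail_bound).
Proof.
move=> Pvv wv sM.
have v0 : vol != 0 by rewrite gt_eqF // (vol_gt0 v).
have dv0 : d v != 0 by rewrite gt_eqF.
(* [G x] is the sum of all [dev i x]. It solves the Poisson equation [Geq], and
   [vol / d v * (G v - G x)] then solves the hitting-time equations. *)
have [G GP] := boolp.choice (fun x => abs_series_bound (dev_tail x)).
have Geq x : G x = dev 0 x + \sum_y P x y * G y.
  have c1 : (series (dev ^~ x) (N + 1)%N @[N --> \oo] --> G x)%classic.
    by rewrite cvg_shiftn; have [] := GP x.
  have c2 : (dev 0 x + \sum_y P x y * series (dev ^~ y) N @[N --> \oo] -->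
     dev 0 x + \sum_y P x y * G y)%classic.
    apply: cvgD; first exact: cvg_cst.
    apply: cvg_big; first exact: add_continuous.
    move=> y _.
    by apply: cvgM; [exact: cvg_cst|have [] := GP y].
  apply: (@cvg_unique _ _ _ _ _ _ c1) => //.
  rewrite (_ : (fun N => _) = (fun N => dev 0 x + \sum_y P x y * series (dev ^~ y) N)) //.
  apply/boolp.funext => N.
  rewrite /series /= addn1 big_nat_recl //; congr (_ + _).
  under eq_bigr => i _ do rewrite devS.
  by rewrite exchange_big /=; apply: eq_bigr => y _; rewrite mulr_sumr.
pose h x := vol / d v * (G v - G x).
exists (h w); split.
  apply: (hitting_system (h := h)); rewrite /h ?subrr ?mulr0 // => x xv.
  (* For [x != v] the term [dev 0 x] is [- (d v / vol)], which the prefactor [vol / d v] turns into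
     the 1 of the equation. *)
  rewrite [X in _ - X]Geq {1}/dev /= (negbTE xv) /=.
  have -> : \sum_y P x y * (vol / d v * (G v - G y)) =
    vol / d v * ((\sum_y P x y) * G v - \sum_y P x y * G y).
    rewrite [X in _ * (X - _)]mulr_suml -sumrB mulr_sumr.
    by apply: eq_bigr => y _; ring.
  rewrite P_sum1; field; by rewrite v0 dv0.
(* The truncation at [v] keeps one term more than that at [w], because the formula pairs
   [kpow i.+1 v v] with [kpow i w v]. The unpaired terms [dev 0 v], [dev 1 v] and [dev 0 w] add up
   to [vol / d v - 1] after scaling, where [P v v = 0] fixes [dev 1 v]. *)
have -> : vol / d v - 1 + vol / d v *
       \sum_(1 <= i < M) (kpow i.+1 v v - kpow i w v) =
    vol / d v * (\sum_(0 <= i < M.+1) dev i v - \sum_(0 <= i < M) dev i w).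
  have M0 : (0 < M)%N by apply: leq_ltn_trans sM.
  have E1 : \sum_(0 <= i < M.+1) dev i v =
      dev 0 v + (dev 1 v + \sum_(1 <= i < M) dev i.+1 v).
    by rewrite big_nat_recl // (big_ltn M0).
  rewrite E1 [X in _ * (_ - X)](big_ltn M0).
  have E : \sum_(1 <= i < M) (kpow i.+1 v v - kpow i w v) =
     \sum_(1 <= i < M) dev i.+1 v - \sum_(1 <= i < M) dev i w.
    by rewrite -sumrB; apply: eq_bigr => i _; rewrite /dev /=; ring.
  have -> : dev 0 v = 1 - d v / vol by rewrite /dev /= eqxx.
  have -> : dev 0 w = - (d v / vol) by rewrite /dev /= (negbTE wv) sub0r.
  have -> : dev 1 v = - (d v / vol) by rewrite /dev kpow1 Pvv sub0r.
  rewrite E; field; by rewrite v0 dv0.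
rewrite /h -mulrBr normrM ger0_norm; last by rewrite divr_ge0 // ltW // (vol_gt0 v).
rewrite ler_wpM2l //; first by rewrite divr_ge0 // ltW // (vol_gt0 v).
have [_ /(_ M.+1 (leqW sM)) Hv] := GP v.
have [_ /(_ M sM) Hw] := GP w.
move: Hv Hw; rewrite !ler_norml => /andP[? ?] /andP[? ?]; apply/andP; split; lra.
Qed.

End ReversibleChain.

(** * Walks in a graph *)

Lemma big_tuple_cons (A : Type) (idx : A) (op : Monoid.com_law idx)
    (T : finType) (t : nat) (F : t.+1.-tuple T -> A) :
  \big[op/idx]_s F s =
  \big[op/idx]_x \big[op/idx]_(s : t.-tuple T) F [tuple of x :: s].
Proof.
rewrite pair_big /=.
rewrite (reindex (fun p : T * t.-tuple T => [tuple of p.1 :: p.2])) //=.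
exists (fun s => (thead s, [tuple of behead s])) => [[x s] _|s _] /=.
  by rewrite theadE; congr (_, _); apply: val_inj.
by rewrite -tuple_eta.
Qed.

Lemma big_tuple0 (A : Type) (idx : A) (op : Monoid.law idx)
    (T : finType) (F : 0.-tuple T -> A) :
  \big[op/idx]_s F s = F [tuple].
Proof. by rewrite (big_pred1 [tuple]) // => s; apply/esym/eqP; exact: tuple0. Qed.

Lemma card_set_natr (R : pzSemiRingType) (T : finType) (Q : pred T) :
  #|[set x | Q x]|%:R = \sum_x (Q x)%:R :> R.
Proof.
rewrite cardsE -sum1_card natr_sum big_mkcond /=.
by apply: eq_bigr => x _; rewrite unfold_in; case: (Q x).
Qed.

Section WalkCounts.
Variables (R : realType) (n : nat) (E : {set 'I_n * 'I_n}).
Implicit Types (x y v w : 'I_n).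

Lemma adj_sym x y : adj E x y = adj E y x.
Proof. by rewrite /adj orbC. Qed.

Lemma deg_natr x : (deg E x)%:R = \sum_y (adj E x y)%:R :> R.
Proof. exact: card_set_natr. Qed.

Lemma nwalks_natr i x :
  (nwalks E i x)%:R = \sum_(s : i.-tuple 'I_n) (path (adj E) x s)%:R :> R.
Proof. exact: card_set_natr. Qed.

Lemma nwalks_to_natr i x v : (nwalks_to E i x v)%:R =
  \sum_(s : i.-tuple 'I_n) (path (adj E) x s && (last x s == v))%:R :> R.
Proof. exact: card_set_natr. Qed.

Lemma nwalksS i x : (nwalks E i.+1 x)%:R =
  \sum_y (adj E x y)%:R * (nwalks E i y)%:R :> R.
Proof.
rewrite nwalks_natr big_tuple_cons; apply: eq_bigr => y _.
rewrite nwalks_natr mulr_sumr; apply: eq_bigr => s _ /=.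
by rewrite -natrM mulnb.
Qed.

Lemma nwalks_toS i x v : (nwalks_to E i.+1 x v)%:R =
  \sum_y (adj E x y)%:R * (nwalks_to E i y v)%:R :> R.
Proof.
rewrite nwalks_to_natr big_tuple_cons; apply: eq_bigr => y _.
rewrite nwalks_to_natr mulr_sumr; apply: eq_bigr => s _ /=.
by rewrite -natrM mulnb andbA.
Qed.

Lemma nwalks0 x : nwalks E 0 x = 1%N.
Proof.
apply/eqP; rewrite -(eqr_nat R) nwalks_natr big_tuple0 /=.
by rewrite mulr1n.
Qed.

Lemma nwalks_to0 x v : (nwalks_to E 0 x v)%:R = (x == v)%:R :> R.
Proof. by rewrite nwalks_to_natr big_tuple0. Qed.

Lemma nwalks_toD i j x v : (nwalks_to E (i + j) x v)%:R =
  \sum_y (nwalks_to E i x y)%:R * (nwalks_to E j y v)%:R :> R.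
Proof.
elim: i x => [|i IH] x.
  rewrite (bigD1 x) //= big1 ?addr0; last first.
    by move=> y yx; rewrite nwalks_to0 eq_sym (negbTE yx) mul0r.
  by rewrite nwalks_to0 eqxx mul1r.
rewrite addSn nwalks_toS.
under [RHS]eq_bigr => y _ do rewrite nwalks_toS mulr_suml.
rewrite exchange_big /=; apply: eq_bigr => y _.
by rewrite IH mulr_sumr; apply: eq_bigr => z _; rewrite mulrA.
Qed.

Lemma nwalks_to_sym i x v :
  (nwalks_to E i x v)%:R = (nwalks_to E i v x)%:R :> R.
Proof.
elim: i x v => [|i IH] x v; first by rewrite !nwalks_to0 eq_sym.
rewrite -[in RHS]addn1 nwalks_toD nwalks_toS; apply: eq_bigr => y _.
rewrite mulrC IH; congr (_ * _).
rewrite nwalks_toS (bigD1 x) //= big1 ?addr0; last first.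
  by move=> z zx; rewrite nwalks_to0 (negbTE zx) mulr0.
by rewrite nwalks_to0 eqxx mulr1 adj_sym.
Qed.

Lemma nwalks_sum i x : (nwalks E i x)%:R = \sum_v (nwalks_to E i x v)%:R :> R.
Proof.
elim: i x => [|i IH] x.
  rewrite nwalks0 (bigD1 x) //= big1 ?addr0; last first.
    by move=> y yx; rewrite nwalks_to0 eq_sym (negbTE yx).
  by rewrite nwalks_to0 eqxx.
rewrite nwalksS; under [RHS]eq_bigr => v _ do rewrite nwalks_toS.
rewrite exchange_big /=; apply: eq_bigr => y _.
by rewrite IH mulr_sumr.
Qed.

(** Expanding the square, symmetry of walk counts makes the sum of squares a count of closed walks
    of length [i + i]. The centre [M / n] is arbitrary here. *)
Lemma walk_variance i (M : R) : n%:R != 0 :> R ->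
  \sum_x \sum_y ((nwalks_to E i x y)%:R - M / n%:R) ^+ 2 =
  \sum_x (nwalks_to E (i + i) x x)%:R
    + - (2 * (M / n%:R)) * \sum_x (nwalks E i x)%:R + M ^+ 2.
Proof.
move=> n_neq0.
have -> : M ^+ 2 = \sum_(x : 'I_n) \sum_(y : 'I_n) (M / n%:R) ^+ 2.
  under eq_bigr => x _ do rewrite sumr_const card_ord.
  by rewrite sumr_const card_ord -mulrnA -[_ *+ (n * n)]mulr_natl natrM; field.
rewrite mulr_sumr -!big_split /=; apply: eq_bigr => x _.
rewrite nwalks_toD nwalks_sum mulr_sumr -!big_split /=.
apply: eq_bigr => y _; rewrite [in X in _ = _ * X + _ + _]nwalks_to_sym; ring.
Qed.

Lemma avoid_probE (w v : 'I_n) t :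
  avoid_prob (R := R) E w v t = avoid (trans E) v t w.
Proof.
elim: t w => [|t IH] w; first by rewrite /avoid_prob big_tuple0 /= andbT.
rewrite /avoid_prob big_tuple_cons /= mulr_sumr; apply: eq_bigr => y _.
rewrite -IH /avoid_prob !mulr_sumr; apply: eq_bigr => s _ /=.
by rewrite -mulnb natrM; ring.
Qed.

Hypothesis E_graph : is_graph E.

Lemma adj_irr x : adj E x x = false.
Proof.
rewrite /adj orbb; apply/negP => /(fintype.subsetP E_graph).
by rewrite inE /= ltnn.
Qed.

(** Handshake identity. A graph stores each edge once, with increasing endpoints, so the two orders
    of a pair never both lie in [E]. *)
Lemma sum_deg : \sum_x (deg E x)%:R = 2 * #|E|%:R :> R.
Proof.
have cE : #|E|%:R = \sum_x \sum_y ((x, y) \in E)%:R :> R.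
  rewrite pair_big /= -sum1_card natr_sum big_mkcond /=.
  by apply: eq_bigr => -[x y] _ /=; case: (_ \in _).
rewrite mulr_natl mulr2n cE [X in _ = X + _]exchange_big -big_split /=.
apply: eq_bigr => y _; rewrite deg_natr -big_split /=; apply: eq_bigr => x _.
rewrite /adj; case e1: ((y, x) \in E); case e2: ((x, y) \in E); rewrite /= ?mulr0n ?addr0 ?add0r //.
have := fintype.subsetP E_graph _ e1; have := fintype.subsetP E_graph _ e2.
by rewrite !inE /= => /ltnW; rewrite leqNgt => /negbTE ->.
Qed.

(** * Walk counts compared with transition powers under degree bounds *)

Variables (a b : R).
Hypothesis a_gt0 : 0 < a.
Hypothesis deg_ge : forall x, a <= (deg E x)%:R.
Hypothesis deg_le : forall x, (deg E x)%:R <= b.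

Let d (x : 'I_n) : R := (deg E x)%:R.
Let P : 'I_n -> 'I_n -> R := trans E.

Let d_gt0 x : 0 < d x.
Proof. exact: lt_le_trans (deg_ge x). Qed.

Let transE x y : P x y = (adj E x y)%:R / d x.
Proof.
by rewrite /P /trans; case: eqP => // e; have := d_gt0 x; rewrite /d e ltxx.
Qed.

Lemma trans_ge0 x y : 0 <= P x y.
Proof. by rewrite transE divr_ge0 ?ler0n. Qed.

Lemma trans_sum1 x : \sum_y P x y = 1.
Proof.
under eq_bigr => y _ do rewrite transE.
by rewrite -mulr_suml -deg_natr mulfV // gt_eqF // d_gt0.
Qed.

Lemma trans_rev x y : d x * P x y = d y * P y x.
Proof.
rewrite !transE adj_sym !(mulrC (d _)) !divfK // ?gt_eqF ?d_gt0 //.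
Qed.

Lemma trans_le x y : P x y <= a^-1.
Proof.
rewrite transE; case: (adj _ _ _); last by rewrite mul0r invr_ge0 ltW.
by rewrite mul1r lef_pV2 ?posrE ?d_gt0 // deg_ge.
Qed.


Let a_ge0 : 0 <= a. Proof. exact: ltW. Qed.

Lemma adj_trans x y : (adj E x y)%:R = d x * P x y.
Proof. by rewrite transE mulrC divfK // gt_eqF ?d_gt0. Qed.

(** A walk's probability is the product of the inverse degrees along it, so each step exchanges
    probability for count at a rate [d x] between [a] and [b]. *)
Lemma nwalks_to_le i x v : (nwalks_to E i x v)%:R <= b ^+ i * kpow P i x v.
Proof.
elim: i x => [|i IH] x; first by rewrite nwalks_to0 expr0 mul1r.
rewrite nwalks_toS /= exprS mulr_sumr; apply: ler_sum => y _.
rewrite adj_trans mulrACA -mulrA [leRHS](_ : _ = b * (P x y * (b ^+ i * kpow P i y v))).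
  rewrite ler_pM ?(ltW (d_gt0 _)) ?deg_le //.
    by rewrite mulr_ge0 ?trans_ge0 ?ler0n.
  by rewrite ler_wpM2l ?trans_ge0.
by ring.
Qed.

Lemma nwalks_to_ge i x v : a ^+ i * kpow P i x v <= (nwalks_to E i x v)%:R.
Proof.
elim: i x => [|i IH] x; first by rewrite nwalks_to0 expr0 mul1r.
rewrite nwalks_toS /= exprS mulr_sumr; apply: ler_sum => y _.
rewrite adj_trans [leLHS](_ : _ = a * (P x y * (a ^+ i * kpow P i y v))).
  rewrite -mulrA ler_pM ?deg_ge ?mulr_ge0 ?trans_ge0 ?exprn_ge0 //.
    by apply: kpow_ge0; exact: trans_ge0.
  by rewrite ler_wpM2l ?trans_ge0.
by ring.
Qed.

Lemma nwalks_le i x : (nwalks E i x)%:R <= b ^+ i.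
Proof.
rewrite nwalks_sum -[leRHS]mulr1 -[X in _ <= _ * X](kpow_sum1 trans_sum1 i x) mulr_sumr.
by apply: ler_sum => y _; exact: nwalks_to_le.
Qed.

Lemma nwalks_ge i x : a ^+ i <= (nwalks E i x)%:R.
Proof.
rewrite nwalks_sum -[leLHS]mulr1 -[X in _ * X <= _](kpow_sum1 trans_sum1 i x) mulr_sumr.
by apply: ler_sum => y _; exact: nwalks_to_ge.
Qed.

Lemma walk_ratio i x v :
  `|(nwalks_to E i x v)%:R / (nwalks E i x)%:R - kpow P i x v|
    <= ((b / a) ^+ i - 1) * kpow P i x v.
Proof.
set W := (nwalks_to _ _ _ _)%:R; set V := (nwalks _ _ _)%:R; set K := kpow _ _ _ _.
have K0 : 0 <= K by apply: kpow_ge0; exact: trans_ge0.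
have V_ge : a ^+ i <= V by exact: nwalks_ge.
have V_le : V <= b ^+ i by exact: nwalks_le.
have W_ge : a ^+ i * K <= W by exact: nwalks_to_ge.
have W_le : W <= b ^+ i * K by exact: nwalks_to_le.
have ai : 0 < a ^+ i by rewrite exprn_gt0.
have V0 : 0 < V by exact: lt_le_trans V_ge.
rewrite expr_div_n; set A := a ^+ i in ai V_ge W_ge *; set B := b ^+ i in V_le W_le *.
have AB : A <= B by exact: le_trans V_ge V_le.
have BK : 0 <= B * K by rewrite mulr_ge0 // (le_trans (ltW ai)).
rewrite ler_norml; apply/andP; split.
  rewrite lerBrDr [leLHS](_ : _ = (2 - B / A) * K); last by ring.
  (* The ratio of counts is naturally at least [A / B * K]; the lower bound is put in the same form
     as the upper one by [A / B + B / A >= 2]. *)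
  apply: le_trans (_ : (A / B) * K <= _).
    rewrite ler_wpM2r //.
    have B0 : 0 < B by exact: lt_le_trans AB.
    have : 0 <= (B - A) ^+ 2 / (A * B) by rewrite divr_ge0 ?sqr_ge0 // mulr_ge0 // ltW.
    have -> : (B - A) ^+ 2 / (A * B) = B / A + A / B - 2.
      by field; rewrite !gt_eqF.
    lra.
  have B0 : 0 < B by exact: lt_le_trans AB.
  rewrite mulrAC ler_pdivrMr // mulrAC ler_pdivlMr //.
  by apply: ler_pM => //; rewrite ?mulr_ge0 // ltW.
rewrite mulrBl mul1r lerD2r ler_pdivrMr //.
apply: le_trans W_le _.
rewrite -[leLHS]mulr1 [leRHS](_ : _ = B * K * (V / A)).
  by rewrite ler_wpM2l // ler_pdivlMr // mul1r.
by field; rewrite gt_eqF.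
Qed.

Lemma trace_kpow_le L :
  \sum_x kpow P L x x <= (\sum_x (nwalks_to E L x x)%:R) / a ^+ L.
Proof.
rewrite mulr_suml; apply: ler_sum => x _.
by rewrite ler_pdivlMr ?exprn_gt0 // mulrC nwalks_to_ge.
Qed.

Variables (s : nat) (q : R).
Hypothesis q_ge0 : 0 <= q.
Hypothesis q_le : q <= 1 / 2.
Hypothesis trace_le : \sum_x kpow P (s + s) x x - 1 <= q.

Lemma hit_main_term k v w : v != w -> ((s + s).+2 <= 3 * k + 2)%N ->
  exists h : R, hit E w v = h%:E /\
   `|h - main_term E k w v| <= 2 * #|E|%:R / d v *
      (2 * tail_bound d v a s q +
       \sum_(1 <= i < 3 * k + 2) 2 * (((b / a) ^+ i - 1) * a^-1)).
Proof.
move=> vw sk.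
have Pvv : P v v = 0 by rewrite transE adj_irr mul0r.
have wv : w != v by rewrite eq_sym.
have [h [hcvg hB]] := hitting_time_expansion trans_ge0 trans_sum1 d_gt0 trans_rev
  a_gt0 deg_ge trans_le q_ge0 q_le trace_le Pvv wv sk.
exists h; split.
  rewrite /hit; apply: cvg_lim => //.
  rewrite (_ : (fun n0 => _) = (fun N => (series (avoid (trans E) v ^~ w) N)%:E)).
    by apply: cvg_EFin => //; apply: nearW.
  apply/boolp.funext => N; rewrite /series /= -sumEFin.
  by apply: eq_bigr => t _; rewrite avoid_probE.
have dv0 : d v != 0 by rewrite gt_eqF ?d_gt0.
rewrite /main_term /= -/(deg E v) -/(d v).
rewrite [X in `|h - (X / _ - _ + _)| ](_ : _ = 2 * #|E|%:R) //.
move: hB; rewrite sum_deg; set vd := 2 * _ / _.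
have vd0 : 0 <= vd by rewrite divr_ge0 ?mulr_ge0 ?ler0n.
set S := \sum_(1 <= i < _) (_ - _); move=> hB.
set S' := \sum_(u in _) _.
(* First-step decomposition at [v]: [P v u] is [1 / d v] on the neighbourhood, so the return
   probability is a neighbourhood average. *)
have SE : S = (d v)^-1 * \sum_(u in nbhd E v) \sum_(1 <= i < 3 * k + 2)
    (kpow P i u v - kpow P i w v).
  rewrite exchange_big /= mulr_sumr; apply: eq_bigr => i _.
  rewrite sumrB sumr_const -/(deg E v) -mulr_natl mulrBr mulrA mulVf // mul1r.
  congr (_ - _); rewrite /= mulr_sumr [RHS]big_mkcond /=; apply: eq_bigr => u _.
  rewrite transE inE; case: (adj _ _ _); last by rewrite !mul0r.
  by rewrite mul1r.
have diff : `|S - 1 / d v * S'| <=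
    \sum_(1 <= i < 3 * k + 2) 2 * (((b / a) ^+ i - 1) * a^-1).
  set B := \sum_(1 <= i < _) 2 * _.
  rewrite SE mul1r -mulrBr normrM ger0_norm ?invr_ge0 ?(ltW (d_gt0 _)) //.
  rewrite mulrC ler_pdivrMr ?d_gt0 // /S' -sumrB.
  have -> : B * d v = \sum_(u in nbhd E v) B.
    by rewrite sumr_const -/(deg E v) mulr_natr.
  apply: le_trans (ler_norm_sum _ _ _) _; apply: ler_sum => u _.
  rewrite -sumrB; apply: le_trans (ler_norm_sum _ _ _) _.
  apply: ler_sum_nat => i /andP[i1 _].
  have H x : `|(nwalks_to E i x v)%:R / (nwalks E i x)%:R - kpow P i x v|
      <= ((b / a) ^+ i - 1) * a^-1.
    apply: le_trans (walk_ratio _ _ _) _; apply: ler_wpM2l.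
      rewrite subr_ge0 exprn_ege1 // ler_pdivlMr // mul1r.
      exact: le_trans (deg_ge v) (deg_le v).
    (* The bound [a^-1] holds only for positive powers, hence the sum starting at 1. *)
    case: i i1 => // i _.
    by apply: kpow_le; [exact: trans_ge0|exact: trans_sum1|exact: trans_le].
  have aux (e f g l c : R) : `|g - e| <= c -> `|l - f| <= c ->
      `|e - f - (g - l)| <= 2 * c.
    by rewrite !ler_norml => /andP[? ?] /andP[? ?]; apply/andP; split; lra.
  exact: aux (H u) (H w).
have -> : h - (vd - 1 + vd * (1 / d v) * S') =
   (h - (vd - 1 + vd * S)) + vd * (S - 1 / d v * S') by ring.
apply: le_trans (ler_normD _ _) _.
rewrite [leRHS]mulrDr; apply: lerD; first by rewrite [2 * tail_bound _ _ _ _ _]mulr_natl mulr2n.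
by rewrite normrM (ger0_norm vd0) ler_wpM2l.
Qed.

End WalkCounts.

(** * Expectations over G(n,p) and closed walks *)

Section Edges.
Variable n : nat.
Implicit Types (x y z : 'I_n) (s : seq 'I_n) (E : {set 'I_n * 'I_n}).

(** Normal form of an unordered pair. A loop is sent to a diagonal pair, which lies outside
    [upper]. *)
Definition edge x y : 'I_n * 'I_n := if (x < y)%N then (x, y) else (y, x).

Lemma edge_upper x y : (edge x y \in upper n) = (x != y).
Proof.
rewrite /edge inE -(inj_eq val_inj) /=; case: ifP => //= xy; first by rewrite ltn_eqF.
by rewrite ltn_neqAle leqNgt xy andbT eq_sym.
Qed.

Lemma edge_eq x y z t : edge x y = edge z t ->
  (x = z /\ y = t) \/ (x = t /\ y = z).
Proof. by rewrite /edge; case: ifP => _; case: ifP => _ [-> ->]; auto. Qed.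

Lemma edge_inj x : injective (edge x).
Proof. by move=> y z /edge_eq [[_ ->] | [-> ->]]. Qed.

Lemma adj_edge E x y : is_graph E -> adj E x y = (edge x y \in E).
Proof.
move=> /fintype.subsetP Eg; rewrite /adj /edge; case: ifP => xy.
  case: (boolP ((y, x) \in E)) => [/Eg|_]; last by rewrite orbF.
  by rewrite inE /= ltnNge (ltnW xy).
by case: (boolP ((x, y) \in E)) => // /Eg; rewrite inE /= xy.
Qed.

Fixpoint wedges x s : seq ('I_n * 'I_n) :=
  if s is y :: s' then edge x y :: wedges y s' else [::].

Lemma size_wedges x s : size (wedges x s) = size s.
Proof. by elim: s x => //= y s IH x; rewrite IH. Qed.

Lemma wedges_rcons x s y :
  wedges x (rcons s y) = rcons (wedges x s) (edge (last x s) y).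
Proof. by elim: s x => //= z s IH x; rewrite IH. Qed.

Lemma path_wedges E x s : is_graph E ->
  path (adj E) x s = all (mem E) (wedges x s).
Proof. by move=> Eg; elim: s x => //= y s IH x; rewrite adj_edge // IH. Qed.

Lemma mem_wedges x s y z : edge y z \in wedges x s ->
  (y \in x :: s) /\ (z \in x :: s).
Proof.
elim: s x => //= t s IH x; rewrite inE => /orP[/eqP/edge_eq|/IH[]].
  by case=> -[-> ->]; rewrite !inE !eqxx !orbT.
by rewrite !inE => -> ->; rewrite !orbT.
Qed.

(* In the second alternative the walk traces a tree; [l] plays the role of the
   distance to the root x, and a step along an old edge lowers it by at most 1. *)
Lemma walk_tree_or_cycle x s : let V := [set z in x :: s] in
  let W := [set e in wedges x s] in
  (#|V| <= #|W|)%N \/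
  (#|V| <= #|W|.+1)%N /\ exists l : 'I_n -> nat,
    [/\ l x = 0%N, forall y z, edge y z \in wedges x s -> (l y <= (l z).+1)%N
      & (2 * #|W| <= size s + l (last x s))%N].
Proof.
have set_rcons (T : finType) (r : seq T) u :
    [set z in rcons r u] = u |: [set z in r].
  by apply/finset.setP => z; rewrite !inE mem_rcons inE.
elim/last_ind: s => [|s y IH] /=.
  right; split; first by rewrite finset.set_seq1 cards1.
  exists (fun=> 0%N); split=> //.
  by rewrite (_ : [set e in [::]] = finset.set0) ?cards0 //; apply/finset.setP => e; rewrite !inE.
move: IH; rewrite -rcons_cons wedges_rcons !set_rcons !finset.cardsU1 /=.
set V := [set z in _]; set W := [set e in _]; set u := last x s => IH.
have uin : u \in x :: s by exact: mem_last.
rewrite last_rcons size_rcons.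
have -> : (y \in V) = (y \in x :: s) by rewrite inE.
have -> : (edge u y \in W) = (edge u y \in wedges x s) by rewrite inE.
(* Old edge: no vertex or edge is gained, while the level drops by at most 1 and the length grows by
   1. *)
case: (boolP (edge u y \in wedges x s)) => eW.
  have [_ yV] := mem_wedges eW.
  rewrite yV !add0n; case: IH => [|[VW [l [l0 lW lL]]]]; [by left | right].
  split=> //; exists l; split=> //.
    by move=> a b; rewrite mem_rcons inE => /orP[/eqP e|]; apply: lW; rewrite ?e.
  by have := lW _ _ eW; lia.
(* New edge to an old vertex: only the edge count grows, so a cycle is closed and the first
   alternative holds from then on. *)
case: (boolP (y \in x :: s)) => yV.
  by left; case: IH => [|[]]; rewrite /=; lia.
case: IH => [VW|[VW [l [l0 lW lL]]]]; [by left; rewrite /=; lia | right].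
split; first by rewrite /=; lia.
have neq a : a \in x :: s -> (a == y) = false.
  by move=> ain; apply/eqP => e; rewrite e (negbTE yV) in ain.
(* New vertex: it is placed one level above [u], so that length plus level grows by 2, as does twice
   the edge count. *)
exists (fun z => if z == y then (l u).+1 else l z); split.
- by rewrite neq // mem_head.
- move=> a b; rewrite mem_rcons inE => /orP[/eqP/edge_eq|/[dup] /lW lab /mem_wedges[ain bin]].
    by case=> -[-> ->]; rewrite eqxx neq //; lia.
  by rewrite !neq.
- by rewrite eqxx /=; lia.
Qed.

Lemma closed_walk_tree_or_cycle x s : last x s = x ->
  let V := [set z in x :: s] in let W := [set e in wedges x s] in
  (#|V| <= #|W|)%N \/ (#|V| <= #|W|.+1)%N /\ (2 * #|W| <= size s)%N.
Proof.
move=> cl /=; case: (walk_tree_or_cycle x s) => [|[VW [l [l0 _]]]]; first by left.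
by rewrite cl l0 addn0; right.
Qed.

End Edges.

(** * Expectations over G(n,p) and independence of edges *)

Section Expectation.
Variables (R : realType) (n : nat) (p : R).
Hypothesis p_ge0 : 0 <= p.
Hypothesis p_le1 : p <= 1.
Implicit Types (E S : {set 'I_n * 'I_n}) (f g : {set 'I_n * 'I_n} -> R).

Definition expect f : R := \sum_(E | is_graph E) gnp_weight p E * f E.

Lemma gnp_weight_ge0 E : 0 <= gnp_weight p E.
Proof. by apply: prodr_ge0 => e _; case: ifP => // _; rewrite subr_ge0. Qed.

(** Independence of edges, by distributing the product of sums over all sets of pairs. Pairs outside
    [upper] get factor 0 when present and 1 when absent, which removes the sets that are not
    graphs. *)
Lemma expect_prod (F G : 'I_n * 'I_n -> R) :
  expect (fun E => \prod_(e in upper n) (if e \in E then F e else G e)) =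
  \prod_(e in upper n) (p * F e + (1 - p) * G e).
Proof.
rewrite big_mkcond /=.
rewrite (eq_bigr (fun e => (if e \in upper n then p * F e else 0) +
   (if e \in upper n then (1 - p) * G e else 1))); last first.
  by move=> e _; case: ifP => // _; rewrite add0r.
rewrite bigA_distr (bigID (@is_graph n)) /= [X in _ = _ + X]big1 ?addr0.
  rewrite /expect; apply: eq_bigr => E /fintype.subsetP EU.
  rewrite /gnp_weight -big_split /= big_mkcond /=; apply: eq_bigr => e _.
  case: (boolP (e \in E)) => [/EU ->|_]; first by [].
  by case: ifP.
move=> E; rewrite /is_graph => /fintype.subsetPn[e eE eU].
by rewrite (bigD1 e) //= eE (negbTE eU) mul0r.
Qed.

Lemma expect_prod_const S (F G : R) : S \subset upper n ->
  expect (fun E => \prod_(e in S) (if e \in E then F else G)) =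
  (p * F + (1 - p) * G) ^+ #|S|.
Proof.
move=> /fintype.subsetP SU.
have E1 (H : 'I_n * 'I_n -> R) : \prod_(e in S) H e =
    \prod_(e in upper n) (if e \in S then H e else 1).
  rewrite big_mkcond [RHS]big_mkcond /=; apply: eq_bigr => e _.
  by case: (boolP (e \in S)) => [/SU -> //|_]; case: ifP.
rewrite -prodr_const E1.
transitivity (expect (fun E => \prod_(e in upper n)
   (if e \in E then (if e \in S then F else 1) else (if e \in S then G else 1)))).
  apply: eq_bigr => E _; congr (_ * _); rewrite E1; apply: eq_bigr => e _.
  by do 2 case: ifP.
rewrite expect_prod; apply: eq_bigr => e _.
by case: ifP => // _; rewrite !mulr1 addrC subrK.
Qed.

Lemma expect_const (c : R) : expect (fun=> c) = c.
Proof.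
rewrite /expect -mulr_suml -[RHS]mul1r; congr (_ * _).
have := @expect_prod_const finset.set0 1 1 (finset.sub0set _).
rewrite cards0 expr0 => <-; apply: eq_bigr => E _.
by rewrite finset.big_set0 mulr1.
Qed.

Lemma expectD f g : expect (fun E => f E + g E) = expect f + expect g.
Proof. by rewrite /expect -big_split; apply: eq_bigr => E _; rewrite mulrDr. Qed.

Lemma expectZ (c : R) f : expect (fun E => c * f E) = c * expect f.
Proof. by rewrite /expect mulr_sumr; apply: eq_bigr => E _; rewrite mulrCA. Qed.

Lemma expect_sum (I : finType) (Q : pred I) (f : I -> {set 'I_n * 'I_n} -> R) :
  expect (fun E => \sum_(i | Q i) f i E) = \sum_(i | Q i) expect (f i).
Proof.
rewrite /expect exchange_big /=; apply: eq_bigr => E _.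
by rewrite mulr_sumr.
Qed.

Lemma eq_expect f g : (forall E, is_graph E -> f E = g E) -> expect f = expect g.
Proof. by move=> fg; apply: eq_bigr => E /fg ->. Qed.

(** First-moment bound: [f] dominates the indicator of the failure of [Q], and the total mass is
    1. *)
Lemma gnp_prob_ge (Q : {set 'I_n * 'I_n} -> Prop) f :
  (forall E, is_graph E -> 0 <= f E) ->
  (forall E, is_graph E -> ~ Q E -> 1 <= f E) ->
  1 - expect f <= gnp_prob n p Q.
Proof.
move=> f0 f1; rewrite lerBlDr -(expect_const 1) /gnp_prob /expect.
rewrite big_mkcondr -big_split /=; apply: ler_sum => E Eg.
have w0 := gnp_weight_ge0 E.
case: ifPn => [_|/asboolPn nQ].
  by rewrite mulr1 lerDl mulr_ge0 // f0.
by rewrite add0r ler_wpM2l // f1.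
Qed.

(** Moment generating function of a binomial variable: the degree counts the [n.-1] distinct pairs
    [edge x y] with [y != x]. *)
Lemma expect_exp_deg (l : R) (x : 'I_n) :
  expect (fun E => expR (l * (deg E x)%:R)) = (p * expR l + (1 - p)) ^+ n.-1.
Proof.
have cS : #|(@edge n x) @: [set~ x]| = n.-1.
  by rewrite finset.card_imset ?finset.cardsC1 ?card_ord //; exact: edge_inj.
rewrite -[1 - p]mulr1 -cS -expect_prod_const; last first.
  apply/fintype.subsetP => e /finset.imsetP[y]; rewrite finset.in_setC1 => yx ->.
  by rewrite edge_upper eq_sym.
apply: eq_expect => E Eg.
rewrite finset.big_imset /=; last by move=> y z _ _; exact: edge_inj.
rewrite expRM_natr -prodr_const big_mkcond [RHS]big_mkcond /=.
apply: eq_bigr => y _; rewrite finset.in_setC1 inE adj_edge //.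
case: eqVneq => [->|] //=.
by case: ifP => // /(fintype.subsetP Eg); rewrite edge_upper eqxx.
Qed.

(** A walk is present exactly when its distinct edges are, so repeated edges are paid for once. A
    walk with a loop step is never present. *)
Lemma expect_path (x : 'I_n) (s : seq 'I_n) :
  expect (fun E => (path (adj E) x s)%:R) =
  (all (mem (upper n)) (wedges x s))%:R * p ^+ #|[set e in wedges x s]|.
Proof.
case: (boolP (all _ _)) => [/allP sU|sU].
  rewrite mul1r -[X in X ^+ _](_ : p * 1 + (1 - p) * 0 = p); last by ring.
  rewrite -expect_prod_const; last first.
    by apply/fintype.subsetP => e; rewrite inE => /sU.
  apply: eq_expect => E Eg; rewrite path_wedges //.
  case: (boolP (all _ _)) => [/allP sE|/allPn[e es /= eE]].
    by rewrite big1 // => e; rewrite inE => /sE /= ->.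
  by rewrite (bigD1 e) ?inE //= (negbTE eE) mul0r.
rewrite mul0r -[RHS](expect_const 0); apply: eq_expect => E Eg.
rewrite path_wedges //; case: (boolP (all _ _)) => // /allP sE.
by case/negP: sU; apply/allP => e /sE /(fintype.subsetP Eg).
Qed.

(** * Expected numbers of walks and closed walks *)

Lemma count_loopfree t (x : 'I_n) :
  \sum_(s : t.-tuple 'I_n) (all (mem (upper n)) (wedges x s))%:R
    = n.-1%:R ^+ t :> R.
Proof.
elim: t x => [|t IH] x; first by rewrite big_tuple0 expr0.
rewrite big_tuple_cons exprS.
under eq_bigr => y _.
  under eq_bigr => s _ do rewrite /= -mulnb natrM edge_upper.
  rewrite -mulr_sumr IH; over.
rewrite -mulr_suml; congr (_ * _).
have <- : #|[set~ x]| = n.-1 by rewrite finset.cardsC1 card_ord.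
rewrite -sum1_card natr_sum [RHS]big_mkcond; apply: eq_bigr => y _.
by rewrite finset.in_setC1 eq_sym; case: eqP.
Qed.

Lemma expect_nwalks_ge t (x : 'I_n) :
  n.-1%:R ^+ t * p ^+ t <= expect (fun E => (nwalks E t x)%:R).
Proof.
rewrite -(count_loopfree t x) mulr_suml.
rewrite (_ : expect _ = \sum_(s : t.-tuple 'I_n) expect (fun E => (path (adj E) x s)%:R)).
  apply: ler_sum => s _; rewrite expect_path ler_wpM2l ?ler0n //.
  apply: ler_wiXn2l => //; rewrite cardsE.
  by apply: leq_trans (card_size _) _; rewrite size_wedges size_tuple.
by rewrite -expect_sum; apply: eq_expect => E _; rewrite nwalks_natr.
Qed.

Lemma count_closed t (z x : 'I_n) :
  \sum_(s : t.+1.-tuple 'I_n) (last z s == x)%:R = n%:R ^+ t :> R.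
Proof.
elim: t z => [|t IH] z.
  rewrite big_tuple_cons expr0 (bigD1 x) //= big_tuple0 /= eqxx big1 ?addr0 //.
  by move=> y yx; rewrite big_tuple0 /= (negbTE yx).
rewrite big_tuple_cons /=; under eq_bigr => y _ do rewrite IH.
by rewrite sumr_const card_ord exprS mulr_natl.
Qed.

(* Each further vertex is either new (n choices, weight 1/n) or one of the at
   most K earlier ones; the last step is forced. *)
Lemma sum_closed_weight (K t : nat) (z x : 'I_n) (A : {set 'I_n}) :
  x \in A -> (#|A| + t <= K)%N ->
  \sum_(s : t.+1.-tuple 'I_n)
      (last z s == x)%:R * (n%:R^-1) ^+ #|A :|: [set y in tval s]|
    <= K.+1%:R ^+ t * n%:R^-1 ^+ #|A| :> R.
Proof.
have n0 : (0 < n)%N by apply: leq_trans (ltn_ord x).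
have nR : 0 < n%:R :> R by rewrite ltr0n.
have ni : 0 <= n%:R^-1 :> R by rewrite invr_ge0 ltW.
elim: t z A => [|t IH] z A xA AK.
  rewrite big_tuple_cons expr0 mul1r (bigD1 x) //= [X in _ + X]big1 ?addr0; last first.
    by move=> y yx; rewrite big_tuple0 /= (negbTE yx) mul0r.
  rewrite big_tuple0 /= eqxx mul1r finset.set_seq1.
  suff -> : A :|: [set x] = A by [].
  by apply/finset.setUidPl; rewrite finset.sub1set.
rewrite big_tuple_cons.
have step (y : 'I_n) : \sum_(s : t.+1.-tuple 'I_n) (last z [tuple of y :: s] == x)%:R *
      (n%:R^-1) ^+ #|A :|: [set u in tval [tuple of y :: s]]|
    <= K.+1%:R ^+ t * n%:R^-1 ^+ #|A| * ((y \in A)%:R + n%:R^-1) :> R.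
  rewrite (eq_bigr (fun s : t.+1.-tuple 'I_n => (last y s == x)%:R *
     n%:R^-1 ^+ #|(y |: A) :|: [set u in tval s]|)); last first.
    move=> s _; congr (_ * _ ^+ _).
    suff -> : A :|: [set u in tval [tuple of y :: s]] =
        (y |: A) :|: [set u in tval s] by [].
    by apply/finset.setP => u; rewrite !inE orbCA orbA.
  apply: le_trans (IH y (y |: A) _ _) _.
  - by rewrite inE xA orbT.
  - by rewrite finset.cardsU1; move: AK; case: (y \in A) => /=; lia.
  rewrite -mulrA ler_wpM2l ?exprn_ge0 ?ler0n // finset.cardsU1.
  case: (y \in A) => /=; first by rewrite mulrDr mulr1 lerDl mulr_ge0 ?exprn_ge0.
  by rewrite add0r exprS mulrC.
apply: le_trans (ler_sum _ (fun y _ => step y)) _.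
rewrite -mulr_sumr big_split /= sumr_const card_ord -[n%:R^-1 *+ n]mulr_natr mulVf ?gt_eqF //.
have -> : \sum_(y : 'I_n) (y \in A)%:R = #|A|%:R :> R.
  by rewrite -sum1_card natr_sum [RHS]big_mkcond; apply: eq_bigr => y _; case: (y \in A).
rewrite exprSr mulrAC ler_wpM2r ?exprn_ge0 // ler_wpM2l ?exprn_ge0 ?ler0n //.
by rewrite natr1 ler_nat; lia.
Qed.

(** Closed walks without repeated edges give the main term. Each other walk on V vertices has
    probability at most [D ^+ t] times n^(-V), and [sum_closed_weight] sums these weights; the
    result is smaller by a factor of order [D]. *)
Lemma expect_closed_walks_le s : 1 <= n%:R * p -> n%:R <= (n%:R * p) ^+ s ->
  expect (fun E => \sum_x (nwalks_to E (s.+1 + s.+1) x x)%:R) <=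
  (n%:R * p) ^+ (s.+1 + s.+1) *
    (1 + (s.+1 + s.+1).+1%:R ^+ (s + s.+1) / (n%:R * p)).
Proof.
move=> np1 nnp.
have [n0|n0] := posnP n; first by rewrite n0 mul0r ler10 in np1.
have nR : 0 < n%:R :> R by rewrite ltr0n.
set D := n%:R * p in np1 nnp *.
have D0 : 0 < D by exact: lt_le_trans np1.
set t := (s + s.+1)%N.
have Lt : (s.+1 + s.+1)%N = t.+1 by [].
rewrite Lt.
have term (x : 'I_n) (u : t.+1.-tuple 'I_n) :
    expect (fun E => (path (adj E) x u && (last x u == x))%:R) <=
    p ^+ t.+1 * (last x u == x)%:R + D ^+ t *
     ((last x u == x)%:R * n%:R^-1 ^+ #|[set x] :|: [set y in tval u]|).
  case: eqP => [cl|_]; last first.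
    rewrite (eq_expect (g := fun=> 0)) ?expect_const.
      by rewrite mulr0 mul0r mulr0 addr0.
    by move=> E _; rewrite andbF.
  rewrite (eq_expect (g := fun E => (path (adj E) x u)%:R)); last first.
    by move=> E _; rewrite andbT.
  have -> : [set x] :|: [set y in tval u] = [set y in x :: tval u].
    by apply/finset.setP => y; rewrite !inE.
  rewrite expect_path mulr1 mul1r.
  have := closed_walk_tree_or_cycle cl; rewrite /= size_tuple.
  set v := #|[set y in _]|; set e := #|[set y in wedges _ _]| => ve.
  have eL : (e <= t.+1)%N.
    rewrite /e cardsE; apply: leq_trans (card_size _) _.
    by rewrite size_wedges size_tuple.
  apply: le_trans (_ : p ^+ e <= _).
    by rewrite -[leRHS]mul1r ler_wpM2r ?exprn_ge0 // lern1 leq_b1.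
  move: eL; rewrite leq_eqVlt => /orP[/eqP ->|eL].
    by rewrite lerDl mulr_ge0 ?exprn_ge0 ?invr_ge0 ?ler0n ?(ltW D0).
  rewrite ler_wpDl ?exprn_ge0 //.
  have -> : p ^+ e = D ^+ e * n%:R^-1 ^+ e.
    by rewrite -exprMn /D mulrAC mulfV ?mul1r // gt_eqF.
  have niI (i j : nat) : (i <= j)%N -> n%:R^-1 ^+ j <= n%:R^-1 ^+ i :> R.
    by move=> ij; rewrite ler_wiXn2l ?invr_ge0 ?ler0n // invf_le1 // ler1n.
  (* If there are at most as many vertices as edges, [D ^+ e <= D ^+ t] suffices. In the tree case
     one factor [n] is missing, but [e <= s.+1], and [n <= D ^+ s] pays for it. *)
  case: ve => [ve|[ve et]].
    rewrite ler_pM ?exprn_ge0 ?invr_ge0 ?(ltW D0) ?ler0n //; last exact: niI.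
    by rewrite ler_weXn2l.
  have -> : n%:R^-1 ^+ e = n%:R * n%:R^-1 ^+ e.+1 :> R.
    by rewrite exprS mulrA mulfV ?mul1r // gt_eqF.
  rewrite mulrA ler_pM ?exprn_ge0 ?invr_ge0 ?mulr_ge0 ?exprn_ge0 ?(ltW D0) ?ler0n //.
    apply: le_trans (_ : D ^+ s.+1 * D ^+ s <= _); last by rewrite -exprD addnC.
    apply: ler_pM; rewrite ?exprn_ge0 ?ler0n ?(ltW D0) //.
    by rewrite ler_weXn2l //; move: et; rewrite /t; lia.
  exact: niI.
rewrite expect_sum.
apply: le_trans (_ : \sum_(x : 'I_n) (p ^+ t.+1 * n%:R ^+ t +
   D ^+ t * (t.+2%:R ^+ t * n%:R^-1)) <= _).
  apply: ler_sum => x _.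
  rewrite (eq_expect (g := fun E => \sum_(u : t.+1.-tuple 'I_n)
    (path (adj E) x u && (last x u == x))%:R)); last first.
    by move=> E _; rewrite nwalks_to_natr.
  rewrite expect_sum; apply: le_trans (ler_sum _ (fun u _ => term x u)) _.
  rewrite big_split /= -!mulr_sumr count_closed lerD2l ler_wpM2l ?exprn_ge0 ?(ltW D0) //.
  have := @sum_closed_weight t.+1 t x x [set x] (finset.set11 _).
  by rewrite cards1 expr1; apply.
rewrite sumr_const card_ord -[leLHS]mulr_natl [leLHS]mulrDr [leRHS]mulrDr mulr1.
apply: lerD; first by rewrite mulrCA -exprS mulrC /D exprMn.
rewrite exprSr le_eqVlt; apply/orP; left; apply/eqP.
by field; rewrite !gt_eqF.
Qed.

(** In the expansion [walk_variance] the leading terms are [M ^+ 2], [- 2 * M ^+ 2] and [M ^+ 2],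
    and cancel. What remains is the correction for closed walks and the loss in the lower bound on
    the number of walks. *)
Lemma expect_walk_variance_le s M : 1 <= n%:R * p -> n%:R <= (n%:R * p) ^+ s ->
  M = (n%:R * p) ^+ s.+1 ->
  expect (fun E => \sum_x \sum_y ((nwalks_to E s.+1 x y)%:R - M / n%:R) ^+ 2) <=
  M ^+ 2 * (((s.+1 + s.+1).+1%:R ^+ (s + s.+1) + 2 * s.+1%:R) / (n%:R * p)).
Proof.
move=> np1 nnp ME.
have [n0|n0] := posnP n; first by rewrite n0 mul0r ler10 in np1.
have nR : 0 < n%:R :> R by rewrite ltr0n.
have D0 : 0 < n%:R * p by exact: lt_le_trans np1.
have pE : 0 < p by rewrite -(pmulr_rgt0 p nR).
have M0 : 0 < M by rewrite ME exprn_gt0.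
have n_neq0 : n%:R != 0 :> R by rewrite gt_eqF.
rewrite (eq_expect (g := fun E =>
  (\sum_x (nwalks_to E (s.+1 + s.+1) x x)%:R +
   - (2 * (M / n%:R)) * \sum_x (nwalks E s.+1 x)%:R) + M ^+ 2)); last first.
  by move=> E _; exact: walk_variance.
rewrite expectD expectD expect_const expectZ.
have H1 := expect_closed_walks_le np1 nnp.
have H2 : M * (n%:R - s.+1%:R) <= expect (fun E => \sum_x (nwalks E s.+1 x)%:R).
  rewrite expect_sum.
  apply: le_trans (ler_sum _ (fun x _ => expect_nwalks_ge s.+1 x)).
  rewrite sumr_const card_ord -[leRHS]mulr_natl ME exprMn.
  have -> : n.-1%:R = n%:R * (1 - n%:R^-1) :> R.
    by rewrite mulrBr mulr1 mulfV // -subn1 natrB.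
  have ni1 : n%:R^-1 <= 1 :> R by rewrite invf_le1 // ler1n.
  (* Bernoulli's inequality: excluding loop steps costs only a relative [s.+1 / n]. *)
  have bern t : 1 - t%:R / n%:R <= (1 - n%:R^-1) ^+ t :> R.
    elim: t => [|t IH]; first by rewrite mul0r subr0.
    rewrite exprS; apply: le_trans (_ : (1 - n%:R^-1) * (1 - t%:R / n%:R) <= _).
      have : 0 <= t%:R / n%:R * n%:R^-1 :> R by rewrite ?mulr_ge0 ?invr_ge0 ?ler0n.
      by rewrite -natr1; lra.
    by rewrite ler_wpM2l // subr_ge0.
  rewrite exprMn [leRHS](_ : _ = n%:R ^+ s.+1 * p ^+ s.+1 *
    (n%:R * (1 - n%:R^-1) ^+ s.+1)); last by ring.
  rewrite ler_wpM2l ?mulr_ge0 ?exprn_ge0 ?ler0n //.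
  apply: le_trans (_ : n%:R * (1 - s.+1%:R / n%:R) <= _); last by rewrite ler_wpM2l ?ler0n.
  by rewrite mulrBr mulr1 mulrCA mulfV ?mulr1.
have H3 : 2 * (M / n%:R) * (M * (n%:R - s.+1%:R)) <=
   2 * (M / n%:R) * expect (fun E => \sum_x (nwalks E s.+1 x)%:R).
  by rewrite ler_wpM2l // !mulr_ge0 ?invr_ge0 // ltW.
have H4 : 2 * (M / n%:R) * (M * (n%:R - s.+1%:R)) =
    2 * M ^+ 2 - M ^+ 2 * (2 * s.+1%:R / n%:R) by field.
have H5 : M ^+ 2 * (2 * s.+1%:R / n%:R) <= M ^+ 2 * (2 * s.+1%:R / (n%:R * p)).
  rewrite ler_wpM2l ?sqr_ge0 // ler_wpM2l ?mulr_ge0 ?ler0n //.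
  by rewrite lef_pV2 ?posrE // ler_piMr ?ler0n.
rewrite exprD -expr2 -ME in H1.
rewrite [leRHS](_ : _ = M ^+ 2 * ((s.+1 + s.+1).+1%:R ^+ (s + s.+1) / (n%:R * p)) +
  M ^+ 2 * (2 * s.+1%:R / (n%:R * p))); last by ring.
rewrite mulrDr mulr1 in H1.
lra.
Qed.

End Expectation.

(** * Graphs with concentrated degrees and walk counts *)

(** By convexity the power lies below its chord on [0, 1], of slope [2 ^+ i - 1]; the induction
    proves this sharper bound. *)
Lemma exprn_1Dx_le (R : realFieldType) (x : R) i : 0 <= x -> x <= 1 ->
  (1 + x) ^+ i <= 1 + 2 ^+ i * x.
Proof.
move=> x0 x1; suff : (1 + x) ^+ i <= 1 + (2 ^+ i - 1) * x.
  by move/le_trans; apply; rewrite lerD2l ler_wpM2r // gerDl lerN10.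
elim: i => [|i IH]; first by rewrite !expr0 subrr mul0r addr0.
rewrite exprS; apply: le_trans (_ : (1 + x) * (1 + (2 ^+ i - 1) * x) <= _).
  by rewrite ler_wpM2l // addr_ge0.
have t1 : 0 <= 2 ^+ i - 1 :> R by rewrite subr_ge0 exprn_ege1 // ler1n.
rewrite exprS; set t := 2 ^+ i in t1 *.
have : 0 <= (t - 1) * (x * (1 - x)) by rewrite !mulr_ge0 // subr_ge0.
rewrite -subr_ge0 => H; rewrite -subr_ge0.
rewrite [X in 0 <= X](_ : _ = (t - 1) * (x * (1 - x)) - 0) //; ring.
Qed.

(** Inverting [1 - x <= expR (- x)] gives [expR x <= (1 - x)^-1], and
    [(1 - x) * (1 + x + 2 * x ^+ 2)] equals [1 + x ^+ 2 * (1 - 2 * x)]. *)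
Lemma expR_le_quadratic (R : realType) (x : R) : x <= 1 / 2 ->
  expR x <= 1 + x + 2 * x ^+ 2.
Proof.
move=> x2; have x1 : 0 < 1 - x by lra.
rewrite -[x in expR x]opprK expRN -[leRHS]invrK lef_pV2 ?posrE ?expR_gt0 //; last first.
  by rewrite invr_gt0; have := sqr_ge0 x; nra.
apply: le_trans (expR_ge1Dx (- x)).
rewrite invf_ple ?posrE //; last by have := sqr_ge0 x; nra.
rewrite -[leLHS]mul1r ler_pdivrMr //.
have : 0 <= x ^+ 2 * (1 - 2 * x) by rewrite mulr_ge0 ?sqr_ge0 //; lra.
nra.
Qed.

Section Deterministic.
Variables (R : realType) (n : nat) (E : {set 'I_n * 'I_n}) (k : nat) (D r : R).

(** [A] is the relative error of the closed-walk count and [B] that of the lower degree bound to the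
    power [k.+1 + k.+1]; for [r <= 1] the product [(1 + A * r) * (1 + B * r)] is at most
    [1 + (A + B + A * B) * r]. *)
Definition trace_const : R :=
  let A := 1 + 2 * 2 ^+ k.+1 in let B := 2 * 2 ^+ (k.+1 + k.+1) in
  A + B + A * B.

(** The outer 2 bounds [2 * #|E| / d v] by [2 * n]. The first summand accounts for the two tails,
    the second for replacing transition powers by ratios of walk counts. *)
Definition hit_const : R :=
  2 * (2 * (2 * (2 * trace_const * (k.+1 + k.+1)%:R * 2))
    + (3 * k + 2)%:R * (16 * 2 ^+ (3 * k + 2))).

Lemma trace_const_gt0 : 0 < trace_const.
Proof.
by rewrite /trace_const /= !addr_gt0 ?mulr_gt0 ?addr_gt0 ?mulr_gt0 ?exprn_gt0 ?ltr0n.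
Qed.

Hypothesis E_graph : is_graph E.
Hypothesis D_gt0 : 0 < D.
Hypothesis r_gt0 : 0 < r.
Hypothesis r_le : 4 * r <= 1.
Hypothesis r_trace : trace_const * r <= 1 / 2.
Hypothesis deg_ge : forall x, D * (1 - r) <= (deg E x)%:R.
Hypothesis deg_le : forall x, (deg E x)%:R <= D * (1 + r).
Hypothesis variance_le :
  \sum_x \sum_y ((nwalks_to E k.+1 x y)%:R - D ^+ k.+1 / n%:R) ^+ 2
    <= (D ^+ k.+1) ^+ 2 * r.

Let a := D * (1 - r).
Let b := D * (1 + r).
Let a_gt0 : 0 < a. Proof. by rewrite mulr_gt0 // subr_gt0; have := r_gt0; have := r_le; lra. Qed.
Let r1 : r <= 1. Proof. have := r_gt0; have := r_le; lra. Qed.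
Let ainv : a^-1 <= 2 / D.
Proof.
rewrite -[leRHS]invrK lef_pV2 ?posrE ?invr_gt0 ?divr_gt0 // invf_div.
by rewrite ler_pM2l //; have := r_le; have := r_gt0; lra.
Qed.

Let ratio : b / a <= 1 + 4 * r.
Proof.
have rr := r_gt0; have rl := r_le.
rewrite /b /a -mulf_div mulfV ?gt_eqF // mul1r ler_pdivrMr; last by lra.
have : 0 <= r * (1 - 4 * r) by rewrite mulr_ge0; lra.
nra.
Qed.

Lemma trace_close : (0 < n)%N ->
  \sum_x kpow (trans E) (k.+1 + k.+1) x x - 1 <= trace_const * r :> R.
Proof.
move=> n0; set s := k.+1.
have nR : 0 < n%:R :> R by rewrite ltr0n.
have rr := r_gt0; have rl := r_le.
have M0 : 0 < D ^+ s by rewrite exprn_gt0.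
have Y_le : \sum_x (nwalks E s x)%:R <= n%:R * (D ^+ s * (1 + 2 ^+ s * r)).
  apply: le_trans (_ : \sum_(x : 'I_n) D ^+ s * (1 + 2 ^+ s * r) <= _).
    apply: ler_sum => x _.
    apply: le_trans (nwalks_le a_gt0 deg_ge deg_le s x) _.
    by rewrite exprMn ler_wpM2l ?(ltW M0) // exprn_1Dx_le // ltW.
  by rewrite sumr_const card_ord mulr_natl.
(* The variance identity is solved for the number of closed walks, so the upper bound on all walks
   is the one needed. *)
have X_le : \sum_x (nwalks_to E (s + s) x x)%:R <=
    (D ^+ s) ^+ 2 * (1 + (1 + 2 * 2 ^+ s) * r).
  have := variance_le; rewrite walk_variance ?gt_eqF // -/s.
  set M := D ^+ s in M0 Y_le *; set X := \sum_x _; set Y := \sum_x _ in Y_le *.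
  move=> H.
  have : 2 * (M / n%:R) * Y <= 2 * (M / n%:R) * (n%:R * (M * (1 + 2 ^+ s * r))).
    by rewrite ler_wpM2l // mulr_ge0 // divr_ge0 ?ler0n // ltW.
  have -> : 2 * (M / n%:R) * (n%:R * (M * (1 + 2 ^+ s * r))) =
    M ^+ 2 * (2 * (1 + 2 ^+ s * r)) by field; rewrite gt_eqF.
  lra.
have inv_le : (a ^+ (s + s))^-1 <= (D ^+ s) ^- 2 * (1 + 2 * 2 ^+ (s + s) * r).
  have -> : (D ^+ s) ^- 2 = (D ^+ (s + s))^-1 by rewrite exprD expr2.
  rewrite exprMn invfM ler_wpM2l ?invr_ge0 ?exprn_ge0 ?(ltW D_gt0) //.
  rewrite -exprVn; apply: le_trans (_ : (1 + 2 * r) ^+ (s + s) <= _).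
    apply: lerXn2r; rewrite ?nnegrE ?invr_ge0 ?subr_ge0 ?addr_ge0 ?mulr_ge0 ?(ltW rr) //.
    rewrite -[leLHS]mul1r ler_pdivrMr; last by lra.
    have : 0 <= r * (1 - 2 * r) by rewrite mulr_ge0; lra.
    nra.
  apply: le_trans (exprn_1Dx_le _ _ _) _; rewrite ?mulr_ge0 ?(ltW rr) //; first by lra.
  by rewrite lerD2l mulrA [_ * 2]mulrC.
rewrite lerBlDr; apply: le_trans (trace_kpow_le a_gt0 deg_ge _) _.
set A := 1 + 2 * 2 ^+ s in X_le; set B := 2 * 2 ^+ (s + s) in inv_le.
have A0 : 0 <= A by rewrite addr_ge0 // mulr_ge0 // exprn_ge0.
have B0 : 0 <= B by rewrite mulr_ge0 // exprn_ge0.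
apply: le_trans (_ : (1 + A * r) * (1 + B * r) <= _).
  apply: le_trans (ler_pM _ _ X_le inv_le) _.
  - by apply: sumr_ge0 => x _.
  - by rewrite invr_ge0 exprn_ge0 // ltW.
  by rewrite mulrACA mulfV ?mul1r // expf_neq0 // gt_eqF.
rewrite /trace_const /= -/s -/A -/B.
have : 0 <= A * B * (r * (1 - r)) by rewrite !mulr_ge0 // ?subr_ge0 // ltW.
nra.
Qed.

Lemma hit_close v w : (2 <= k)%N -> v != w ->
  exists h : R, hit E w v = h%:E /\
    `|h - main_term E k w v| <= hit_const * (n%:R * r / D).
Proof.
move=> k2 vw.
have n0 : (0 < n)%N by apply: leq_ltn_trans (ltn_ord v).
have rr := r_gt0; have rl := r_le.
have q0 : 0 <= trace_const * r by rewrite mulr_ge0 ?(ltW trace_const_gt0) // ltW.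
(* Here [2 <= k] enters: the truncation at [3 * k + 1] must reach the range where the tail bound
   starts. *)
have sk : ((k.+1 + k.+1).+2 <= 3 * k + 2)%N by lia.
have [h [hE hB]] := hit_main_term E_graph a_gt0 deg_ge deg_le q0 r_trace
  (trace_close n0) vw sk.
exists h; split=> //; apply: le_trans hB _.
have d0 : 0 < (deg E v)%:R :> R by exact: lt_le_trans (deg_ge v).
have ba2 : b / a <= 2 by apply: le_trans ratio _; lra.
have ai0 : 0 <= a^-1 by rewrite invr_ge0 ltW.
have ab : a <= b by exact: le_trans (deg_ge v) (deg_le v).
have ba0 : 0 <= b / a by rewrite divr_ge0 // ?(le_trans _ ab) // ltW.
(* The volume is at most [n * b], and [b <= 2 * a] with [a] at most the degree of [v]. *)
have vol_le : 2 * #|E|%:R / (deg E v)%:R <= 2 * n%:R :> R.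
  rewrite -sum_deg // ler_pdivrMr //.
  apply: le_trans (_ : \sum_(x : 'I_n) b <= _); first by apply: ler_sum => x _.
  rewrite sumr_const card_ord -[leLHS]mulr_natl mulrAC mulrC.
  rewrite ler_wpM2r ?ler0n //.
  move: ba2; rewrite ler_pdivrMr // => /le_trans; apply.
  by rewrite ler_wpM2l.
have tail_le : tail_bound (fun x => (deg E x)%:R) v a k.+1 (trace_const * r) <=
    (2 * (2 * trace_const * (k.+1 + k.+1)%:R * 2)) * (r / D).
  rewrite /tail_bound.
  have sq : Num.sqrt ((deg E v)%:R / a) <= 2.
    apply: le_trans (_ : Num.sqrt (2 ^+ 2) <= _); last first.
      by rewrite sqrtr_sqr ger0_norm.
    rewrite ler_sqrt //; apply: le_trans (_ : b / a <= _).
      by rewrite ler_wpM2r.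
    by apply: le_trans ba2 _; rewrite expr2; lra.
  apply: le_trans (_ : 2 / D * (2 * (trace_const * r) * (k.+1 + k.+1)%:R * 2) <= _).
    have c0 : 0 <= 2 * (trace_const * r) * (k.+1 + k.+1)%:R.
      by apply: mulr_ge0 => //; apply: mulr_ge0.
    apply: ler_pM => //; first by rewrite mulr_ge0 ?sqrtr_ge0.
    by rewrite ler_wpM2l.
  by rewrite le_eqVlt; apply/orP; left; apply/eqP; ring.
have sum_le : \sum_(1 <= i < 3 * k + 2) 2 * (((b / a) ^+ i - 1) * a^-1) <=
    (3 * k + 2)%:R * (16 * 2 ^+ (3 * k + 2)) * (r / D).
  apply: le_trans (_ : \sum_(1 <= i < 3 * k + 2) (16 * 2 ^+ (3 * k + 2)) * (r / D) <= _).
    apply: ler_sum_nat => i /andP[_ ik].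
    apply: le_trans (_ : 2 * ((2 ^+ (3 * k + 2) * (4 * r)) * (2 / D)) <= _); last first.
      by rewrite le_eqVlt; apply/orP; left; apply/eqP; ring.
    rewrite ler_wpM2l //; apply: ler_pM => //.
      rewrite subr_ge0 exprn_ege1 // ler_pdivlMr // mul1r.
      exact: le_trans (deg_ge v) (deg_le v).
    rewrite lerBlDl; apply: le_trans (_ : (1 + 4 * r) ^+ i <= _).
      by rewrite lerXn2r ?nnegrE // addr_ge0 // mulr_ge0 // ltW.
    apply: le_trans (exprn_1Dx_le _ _ _) _; rewrite ?mulr_ge0 ?(ltW rr) //.
    rewrite lerD2l ler_wpM2r ?mulr_ge0 ?(ltW rr) // ler_weXn2l ?ler1n //.
    exact: ltnW.
  rewrite sumr_const_nat -[leLHS]mulr_natl -[leRHS]mulrA.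
  rewrite ler_wpM2r ?ler_nat ?leq_subr // !mulr_ge0 ?exprn_ge0 ?invr_ge0 //.
    exact: ltW.
  exact: ltW.
apply: le_trans (ler_pM _ _ vol_le (lerD (ler_wpM2l _ tail_le) sum_le)) _ => //.
  apply: addr_ge0.
    apply: mulr_ge0 => //; apply: mulr_ge0 => //; apply: mulr_ge0 (sqrtr_ge0 _).
    by apply: mulr_ge0 => //; apply: mulr_ge0.
  apply: sumr_ge0 => i _; rewrite !mulr_ge0 // subr_ge0 exprn_ege1 //.
  by rewrite ler_pdivlMr // mul1r.
by rewrite le_eqVlt; apply/orP; left; apply/eqP; rewrite /hit_const; ring.
Qed.

End Deterministic.

(** * Concentration in G(n,p) *)

Section Concentration.
Variables (R : realType) (n : nat) (p : R).
Hypothesis p_ge0 : 0 <= p.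
Hypothesis p_le1 : p <= 1.
Hypothesis n_gt0 : (0 < n)%N.
Hypothesis ln_ge1 : 1 <= ln (n%:R : R).
Hypothesis np_ge1 : 1 <= n%:R * p.

Let D : R := n%:R * p.
Let r : R := 4 * Num.sqrt (ln n%:R / D).
Hypothesis r_le : 4 * r <= 1.

Let D_gt0 : 0 < D. Proof. exact: lt_le_trans np_ge1. Qed.
Let n_pos : 0 < n%:R :> R. Proof. by rewrite ltr0n. Qed.

Lemma ln_over_gt0 : 0 < ln n%:R / D :> R.
Proof. by rewrite divr_gt0 // (lt_le_trans _ ln_ge1). Qed.

Let r_gt0 : 0 < r. Proof. by rewrite mulr_gt0 // sqrtr_gt0 ln_over_gt0. Qed.

Let r_sqr : D * r ^+ 2 = 16 * ln n%:R.
Proof.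
rewrite /r exprMn sqr_sqrtr ?(ltW ln_over_gt0) //.
by rewrite mulrCA [D * _]mulrC divfK ?gt_eqF // -natrX.
Qed.

Lemma expect_exp_deg_le (l : R) (x : 'I_n) : l <= 1 / 2 ->
  expect p (fun E => expR (l * (deg E x)%:R)) <=
  expR ((n.-1%:R * p) * (l + 2 * l ^+ 2)).
Proof.
move=> l2; rewrite expect_exp_deg.
apply: le_trans (_ : expR (p * (expR l - 1)) ^+ n.-1 <= _).
  apply: lerXn2r; rewrite ?nnegrE ?expR_ge0 //.
    by rewrite addr_ge0 ?mulr_ge0 ?expR_ge0 // subr_ge0.
  apply: le_trans (expR_ge1Dx _).
  by rewrite le_eqVlt; apply/orP; left; apply/eqP; ring.
rewrite -expRM_natl ler_expR -mulrA ler_wpM2l ?ler0n // ler_wpM2l //.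
by rewrite lerBlDl addrA expR_le_quadratic.
Qed.

Let pred_nE : n.-1%:R * p = D - p.
Proof. by rewrite -subn1 natrB // mulrBl mul1r. Qed.

Let expR_ln2 : expR (- (2 * ln n%:R)) = n%:R^-1 ^+ 2 :> R.
Proof. by rewrite expRN expRM_natl lnK ?posrE // exprVn. Qed.

(** Chernoff bound with tilt [r / 4]: the exponent is at most [D * (r ^+ 2 / 8 - r ^+ 2 / 4)], which
    is [- 2 * ln n] since [D * r ^+ 2 = 16 * ln n]. This leaves room for a union bound over
    vertices. *)
Lemma deg_upper_tail (x : 'I_n) :
  expect p (fun E => expR (r / 4 * ((deg E x)%:R - D * (1 + r)))) <= n%:R^-1 ^+ 2.
Proof.
have rr := r_gt0; have rl := r_le; have rs := r_sqr; have pp := p_ge0.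
rewrite (@eq_expect _ _ p _ (fun E => expR (- (r / 4 * (D * (1 + r)))) *
    expR (r / 4 * (deg E x)%:R))); last first.
  by move=> E _; rewrite -expRD; congr expR; ring.
rewrite expectZ -expR_ln2.
apply: le_trans (ler_wpM2l (expR_ge0 _) (expect_exp_deg_le x _)) _; first by lra.
rewrite -expRD ler_expR pred_nE.
have : 0 <= p * (r / 4 + 2 * (r / 4) ^+ 2).
  by rewrite mulr_ge0 // addr_ge0 ?mulr_ge0 ?sqr_ge0 // ?divr_ge0 // ltW.
nra.
Qed.

(** As for the upper tail with the opposite tilt. The mean degree is [D - p] rather than [D], which
    here works against the bound and costs at most the factor [expR 1]. *)
Lemma deg_lower_tail (x : 'I_n) :
  expect p (fun E => expR (- (r / 4) * ((deg E x)%:R - D * (1 - r))))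
    <= expR 1 * n%:R^-1 ^+ 2.
Proof.
have rr := r_gt0; have rl := r_le; have rs := r_sqr; have pp := p_ge0.
have p1 := p_le1.
rewrite (@eq_expect _ _ p _ (fun E => expR (r / 4 * (D * (1 - r))) *
    expR (- (r / 4) * (deg E x)%:R))); last first.
  by move=> E _; rewrite -expRD; congr expR; ring.
rewrite expectZ -expR_ln2.
apply: le_trans (ler_wpM2l (expR_ge0 _) (expect_exp_deg_le x _)) _; first by lra.
rewrite -!expRD ler_expR pred_nE.
have : p * (r / 4) <= 1 * 1 by apply: ler_pM => //; lra.
have : 0 <= p * r ^+ 2 by rewrite mulr_ge0 ?sqr_ge0.
nra.
Qed.

Variable k : nat.
Hypothesis n_le : n%:R <= (n%:R * p) ^+ k :> R.
Hypothesis k_ge2 : (2 <= k)%N.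
Hypothesis r_trace : trace_const R k * r <= 1 / 2.

Definition variance_const : R :=
  (k.+1 + k.+1).+1%:R ^+ (k + k.+1) + 2 * k.+1%:R.

Lemma gnp_hit_close (v w : 'I_n) : v != w ->
  1 - (1 + expR 1 + variance_const) / ln n%:R <= gnp_prob n p (fun E =>
    exists h : R, hit E w v = h%:E /\
      `|h - main_term E k w v| <= hit_const R k * (n%:R * r / D)).
Proof.
move=> vw.
have rr := r_gt0; have rl := r_le; have rs := r_sqr.
have ln0 : 0 < ln n%:R :> R by exact: lt_le_trans ln_ge1.
set M : R := D ^+ k.+1.
have M0 : 0 < M by rewrite exprn_gt0.
set Z := fun E : {set 'I_n * 'I_n} =>
  \sum_x \sum_y ((nwalks_to E k.+1 x y)%:R - M / n%:R) ^+ 2.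
have Z0 E : 0 <= Z E.
  by apply: sumr_ge0 => x _; apply: sumr_ge0 => y _; exact: sqr_ge0.
have c0 : 0 < M ^+ 2 * r by rewrite mulr_gt0 // exprn_gt0.
pose U (E : {set 'I_n * 'I_n}) := \sum_x expR (r / 4 * ((deg E x)%:R - D * (1 + r))).
pose L (E : {set 'I_n * 'I_n}) := \sum_x expR (- (r / 4) * ((deg E x)%:R - D * (1 - r))).
have U0 E : 0 <= U E by apply: sumr_ge0 => x _; exact: expR_ge0.
have L0 E : 0 <= L E by apply: sumr_ge0 => x _; exact: expR_ge0.
(* f dominates the indicator of the bad event: Chernoff bounds for the degrees
   and Markov's inequality for the variance of the walk counts. *)
pose f E := U E + L E + (M ^+ 2 * r)^-1 * Z E.
have V0 E : 0 <= (M ^+ 2 * r)^-1 * Z E by rewrite mulr_ge0 // invr_ge0 ltW.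
apply: le_trans (gnp_prob_ge p_ge0 p_le1 (f := f) _ _); first last.
- move=> E Eg; rewrite leNgt => nQ; apply/negP => f1; apply: nQ.
  have [HU HL HZ] : [/\ U E < 1, L E < 1 & (M ^+ 2 * r)^-1 * Z E < 1].
    by move: f1 (U0 E) (L0 E) (V0 E); rewrite /f => *; split; lra.
  (* A sum of exponentials below 1 forces every exponent to be negative, so both degree bounds hold
     at all vertices at once. *)
  have part (g : 'I_n -> R) (x : 'I_n) : \sum_x expR (g x) < 1 -> g x < 0.
    move=> g1; rewrite ltNge; apply/negP => gx; move: g1; apply/negP.
    rewrite -leNgt (bigD1 x) //= -[leLHS]addr0 lerD //.
      by rewrite -expR0 ler_expR.
    by apply: sumr_ge0 => y _; exact: expR_ge0.
  apply: (hit_close Eg D_gt0 r_gt0) => //.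
  - move=> x; have := part _ x HL; rewrite mulNr oppr_lt0 pmulr_rgt0; last by lra.
    by rewrite subr_gt0 => /ltW.
  - move=> x; have := part _ x HU; rewrite pmulr_rlt0; last by lra.
    by rewrite subr_lt0 => /ltW.
  - by move: HZ; rewrite mulrC ltr_pdivrMr // mul1r => /ltW.
- by move=> E _; rewrite addr_ge0 // addr_ge0.
rewrite lerD2l lerN2 /f !expectD expectZ.
have nln : n%:R^-1 <= (ln n%:R)^-1 :> R.
  rewrite lef_pV2 ?posrE //.
  by have := expR_ge1Dx (ln n%:R : R); rewrite lnK ?posrE //; lra.
have nE : n%:R * n%:R^-1 ^+ 2 = n%:R^-1 :> R by field; rewrite gt_eqF.
have H1 : expect p U <= (ln n%:R)^-1.
  rewrite /U expect_sum.
  apply: le_trans (ler_sum _ (fun x _ => deg_upper_tail x)) _.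
  by rewrite sumr_const card_ord -[leLHS]mulr_natl nE.
have H2 : expect p L <= expR 1 * (ln n%:R)^-1.
  rewrite /L expect_sum.
  apply: le_trans (ler_sum _ (fun x _ => deg_lower_tail x)) _.
  by rewrite sumr_const card_ord -[leLHS]mulr_natl mulrCA nE ler_wpM2l ?expR_ge0.
(* Markov's inequality leaves [variance_const / (D * r)], and [D * r >= D * r ^+ 2 = 16 * ln n]. *)
have H3 : (M ^+ 2 * r)^-1 * expect p Z <= variance_const * (ln n%:R)^-1.
  have H := expect_walk_variance_le p_ge0 p_le1 np_ge1 n_le (erefl M).
  rewrite [leLHS]mulrC ler_pdivrMr //; apply: le_trans H _.
  rewrite -/D -/variance_const.
  rewrite [leRHS](_ : _ = M ^+ 2 * (variance_const * (r / ln n%:R))); last by ring.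
  have v0 : 0 <= variance_const by rewrite addr_ge0 ?mulr_ge0 ?exprn_ge0.
  rewrite ler_wpM2l ?sqr_ge0 // ler_wpM2l //.
  rewrite ler_pdivlMr // mulrC ler_pdivrMr //.
  have : D * r ^+ 2 <= r * D by rewrite expr2 mulrA [leRHS]mulrC ler_piMr ?mulr_ge0 // ?ltW //; lra.
  rewrite rs; lra.
apply: le_trans (lerD (lerD H1 H2) H3) _.
by rewrite le_eqVlt; apply/orP; left; apply/eqP; ring.
Qed.

End Concentration.

(** * Asymptotics in n and conclusion *)

Lemma err_termE (R : realType) (n : nat) (p : R) : 0 < p -> (0 < n)%N ->
  n%:R * (4 * Num.sqrt (ln n%:R / (n%:R * p))) / (n%:R * p) = 4 * err_term n p.
Proof.
move=> p0 n0; have nR : 0 < n%:R :> R by rewrite ltr0n.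
rewrite /err_term.
have -> : p `^ (3%:R / 2%:R) = p * Num.sqrt p.
  rewrite (_ : 3%:R / 2%:R = 1 + 2^-1); last by field.
  by rewrite powRD ?powRr1 ?powR12_sqrt ?(ltW p0) // (gt_eqF p0) implybT.
have sn : 0 < Num.sqrt (n%:R : R) by rewrite sqrtr_gt0.
have sp : 0 < Num.sqrt p by rewrite sqrtr_gt0.
have ln0 : 0 <= ln n%:R :> R by rewrite ln_ge0 // ler1n.
rewrite sqrtrM // sqrtrV ?mulr_ge0 ?(ltW p0) // sqrtrM ?ler0n //.
field; by rewrite !gt_eqF.
Qed.

Lemma near_ln_ge (R : realType) (A : R) :
  (\forall n \near \oo, A <= ln (n%:R : R))%classic.
Proof.
near=> n; have nA : expR A <= n%:R by near: n; exact: nbhs_infty_ger.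
by rewrite -[A]expRK ler_ln ?posrE ?expR_gt0 // (lt_le_trans _ nA) ?expR_gt0.
Unshelve. all: by end_near. Qed.

Local Open Scope classical_set_scope.
Local Open Scope ring_scope.
Unset Implicit Arguments.

Theorem theorem1p2 (R : realType) (k : nat) (c : R) (p : nat -> R) :
  (2 <= k)%N -> 0 < c ->
  (\forall n \near \oo,
      ln (n%:R : R) / ((n%:R : R) `^ ((k - 1)%:R / k%:R)) <= p n /\
      c * (ln (n%:R : R)) ^+ 4 / n%:R <= 1 - p n) ->
  exists C : R, 0 < C /\
    forall eps : R, 0 < eps ->
    \forall n \near \oo, forall v w : 'I_n, v != w ->
      1 - eps <= gnp_prob n (p n) (fun E =>
        exists h : R, hit E w v = h%:E /\
          `|h - main_term E k w v| <= C * err_term n (p n)).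
Proof.
move=> k2 c0 hp.
have k0 : (0 < k)%N by exact: leq_trans k2.
have tc0 := trace_const_gt0 R k.
have hc0 : 0 < hit_const R k.
  by rewrite /hit_const !(mulr_gt0, addr_gt0, exprn_gt0, ltr0n, tc0) // addn2.
(* The 4 is the one in [err_termE]; the constant depends on [k] only and is fixed before [eps]. *)
exists (4 * hit_const R k); split; first by rewrite mulr_gt0.
move=> eps eps0.
(* Below [r0] both smallness conditions on the degree fluctuation hold: [4 * r <= 1] and
   [trace_const R k * r <= 1 / 2]. *)
pose r0 : R := Num.min (1 / 4) ((2 * trace_const R k)^-1).
have r0_gt0 : 0 < r0.
  rewrite /r0 lt_min; apply/andP; split; first lra.
  by rewrite invr_gt0 mulr_gt0.
pose K := 1 + expR 1 + variance_const R k.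
near=> n => v w vw.
have n0 : (0 < n)%N by apply: leq_ltn_trans (ltn_ord v).
have nR : 0 < n%:R :> R by rewrite ltr0n.
have [p_lo p_hi] : ln (n%:R : R) / ((n%:R : R) `^ ((k - 1)%:R / k%:R)) <= p n /\
      c * (ln (n%:R : R)) ^+ 4 / n%:R <= 1 - p n by near: n.
have ln1 : 1 <= ln (n%:R : R) by near: n; exact: near_ln_ge.
have lnK : K / eps <= ln (n%:R : R) by near: n; exact: near_ln_ge.
have nB : ((4 / r0) ^+ 2) ^+ k <= n%:R :> R by near: n; exact: nbhs_infty_ger.
have ln0 : 0 < ln (n%:R : R) by exact: lt_le_trans ln1.
have kR : 0 < k%:R :> R by rewrite ltr0n.
(* With [t] the k-th root of [n], the lower bound on [p n] becomes [t * ln n <= n * p n]. It yields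
   [n <= (n * p n) ^+ k] and makes the fluctuation at most [4 / sqrt t], hence at most [r0] by
   [nB]. *)
pose t : R := n%:R `^ (k%:R^-1).
have t0 : 0 < t by exact: powR_gt0.
have tk : t ^+ k = n%:R.
  by rewrite -powR_mulrn ?(ltW t0) // -powRrM mulVf ?gt_eqF // powRr1 // ltW.
have tk1 : n%:R `^ ((k - 1)%:R / k%:R) = t ^+ k.-1.
  by rewrite -powR_mulrn ?(ltW t0) // -powRrM mulrC subn1.
have D_ge : t * ln n%:R <= n%:R * p n.
  move: p_lo; rewrite tk1 -(ler_pM2l nR) => /(le_trans _); apply.
  have -> : n%:R = t * t ^+ k.-1 by rewrite -exprS prednK.
  rewrite le_eqVlt; apply/orP; left; apply/eqP; field.
  by rewrite expf_neq0 // gt_eqF.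
have D0 : 0 < n%:R * p n by apply: lt_le_trans D_ge; rewrite mulr_gt0.
have p0 : 0 < p n by rewrite -(pmulr_rgt0 _ nR).
have p1 : p n <= 1.
  rewrite -subr_ge0; apply: le_trans p_hi.
  by rewrite divr_ge0 ?ler0n // mulr_ge0 ?exprn_ge0 // ltW.
have tB : (4 / r0) ^+ 2 <= t.
  by rewrite -(@ler_pXn2r _ k) ?nnegrE ?sqr_ge0 ?(ltW t0) ?tk.
have t1 : 1 <= t.
  apply: le_trans tB; rewrite exprn_ege1 // ler_pdivlMr // mul1r.
  by rewrite ge_min; apply/orP; left; lra.
have D1 : 1 <= n%:R * p n.
  by apply: le_trans D_ge; rewrite -[leLHS]mul1r ler_pM.
have nD : n%:R <= (n%:R * p n) ^+ k.
  rewrite -{1}tk; apply: lerXn2r; rewrite ?nnegrE ?(ltW t0) ?(ltW D0) //.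
  by apply: le_trans D_ge; rewrite ler_peMr // ltW.
have r_le : 4 * Num.sqrt (ln n%:R / (n%:R * p n)) <= r0.
  rewrite mulrC -ler_pdivlMr //.
  rewrite -[leRHS]ger0_norm ?divr_ge0 ?(ltW r0_gt0) // -sqrtr_sqr ler_sqrt ?sqr_ge0 //.
  rewrite (_ : (r0 / 4) ^+ 2 = ((4 / r0) ^+ 2)^-1); last first.
    by field; rewrite gt_eqF.
  rewrite ler_pdivrMr // [leRHS]mulrC ler_pdivlMr ?exprn_gt0 ?divr_gt0 //.
  by apply: le_trans D_ge; rewrite mulrC ler_wpM2r // ltW.
have r_le4 : 4 * (4 * Num.sqrt (ln n%:R / (n%:R * p n))) <= 1.
  have : r0 <= 1 / 4 by rewrite ge_min lexx.
  by move/(le_trans r_le); lra.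
have r_tr : trace_const R k * (4 * Num.sqrt (ln n%:R / (n%:R * p n))) <= 1 / 2.
  have : r0 <= (2 * trace_const R k)^-1 by rewrite ge_min lexx orbT.
  move/(le_trans r_le) => /(ler_wpM2l (ltW tc0)) /le_trans; apply.
  by rewrite le_eqVlt; apply/orP; left; apply/eqP; field; rewrite gt_eqF.
have := gnp_hit_close (ltW p0) p1 n0 ln1 D1 r_le4 nD k2 r_tr vw.
rewrite err_termE // mulrCA mulrA => H; apply: le_trans H.
by rewrite lerD2l lerN2 ler_pdivrMr // mulrC -ler_pdivrMr.
Unshelve. all: by end_near. Qed.
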